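(* Let $\mathcal{H}$ be a separable real Hilbert space, $G\in\mathcal{B}(\mathcal{H},\mathbb{R}^n)$, $\mathcal{C}_{\mathrm{obs}}\in\mathcal{B}(\mathbb{R}^n)$ self-adjoint and positive, $\mathcal{C}_{\mathrm{pr}}\in L_1(\mathcal{H})_{\mathbb{R}}$ positive, $H=G^*\mathcal{C}_{\mathrm{obs}}^{-1}G$, and let $\mathcal{C}_{\mathrm{pos}}$ be the associated posterior covariance. There exist a nondecreasing sequence $(\lambda_i)_i\in\ell^2((-1,0])$ consisting of exactly $\operatorname{rank}(H)$ nonzero elements, and orthonormal bases $(w_i)_i$ and $(v_i)_i$ of $\mathcal{H}$, such that for every $i$ one has $w_i,v_i\in\operatorname{ran}\mathcal{C}_{\mathrm{pr}}^{1/2}$ and $v_i=\sqrt{1+\lambda_i}\,\mathcal{C}_{\mathrm{pos}}^{-1/2}\mathcal{C}_{\mathrm{pr}}^{1/2}w_i$, and such that $$R(\mathcal{C}_{\mathrm{pos}}\Vert\mathcal{C}_{\mathrm{pr}})=\sum_i\lambda_i\,w_i\otimes w_i,$$ $$\mathcal{C}_{\mathrm{pr}}^{1/2}H\mathcal{C}_{\mathrm{pr}}^{1/2}=(\mathcal{C}_{\mathrm{pos}}^{-1/2}\mathcal{C}_{\mathrm{pr}}^{1/2})^*(\mathcal{C}_{\mathrm{pos}}^{-1/2}\mathcal{C}_{\mathrm{pr}}^{1/2})-I=\sum_i\frac{-\lambda_i}{1+\lambda_i}\,w_i\otimes w_i,$$ $$\mathcal{C}_{\mathrm{pos}}^{1/2}H\mathcal{C}_{\mathrm{pos}}^{1/2}=I-(\mathcal{C}_{\mathrm{pr}}^{-1/2}\mathcal{C}_{\mathrm{pos}}^{1/2})^*(\mathcal{C}_{\mathrm{pr}}^{-1/2}\mathcal{C}_{\mathrm{pos}}^{1/2})=\sum_i(-\lambda_i)\,v_i\otimes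 v_i,$$ $$\mathcal{C}_{\mathrm{pos}}^{1/2}\mathcal{C}_{\mathrm{pr}}^{-1/2}w_i=(1+\lambda_i)\,\mathcal{C}_{\mathrm{pos}}^{-1/2}\mathcal{C}_{\mathrm{pr}}^{1/2}w_i\quad\text{for all } i.$$
   Context: Notation: $\mathcal{B}(\cdot,\cdot)$ denotes bounded linear operators; $L_1(\mathcal{H})_{\mathbb{R}}$, $L_2(\mathcal{H})_{\mathbb{R}}$ are the self-adjoint trace-class, resp. Hilbert--Schmidt, operators on $\mathcal{H}$. An operator $T$ is nonnegative ($T\ge0$), resp. positive ($T>0$), if $\langle Th,h\rangle\ge 0$, resp. $>0$, for all $h\ne0$; $T^{1/2}$ is the nonnegative self-adjoint square root. For $k,h\in\mathcal{H}$, $k\otimes h$ is the operator $\tilde h\mapsto\langle h,\tilde h\rangle k$. The dimension of $\mathcal{H}$ may be finite or infinite; bases and eigenvalue sequences are indexed by $i\in\mathbb{N}$ with $i\le\dim\mathcal{H}$. $\ell^2(I)$ denotes the square-summable sequences with values in the interval $I$. Setting (linear Gaussian inverse problem): the prior is $\mathcal{N}(0,\mathcal{C}_{\mathrm{pr}})$ and the data is $Y=GX+\zeta$ with $\zeta\sim\mathcal{N}(0,\mathcal{C}_{\mathrm{obs}})$ independent of $X$. The posterior covariance is $$\mathcal{C}_{\mathrm{pos}}=\mathcal{C}_{\mathrm{pr}}-\mathcal{C}_{\mathrm{pr}}G^*(\mathcal{C}_{\mathrm{obs}}+G\mathcal{C}_{\mathrm{pr}}G^* )^{-1}G\mathcal{C}_{\mathrm{pr}}.$$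 Known facts: $\mathcal{C}_{\mathrm{pos}}$ is self-adjoint, trace-class and positive; $\operatorname{ran}\mathcal{C}_{\mathrm{pos}}=\operatorname{ran}\mathcal{C}_{\mathrm{pr}}$ and $\mathcal{C}_{\mathrm{pos}}^{-1}=\mathcal{C}_{\mathrm{pr}}^{-1}+H$ on $\operatorname{ran}\mathcal{C}_{\mathrm{pr}}$; prior and posterior are equivalent Gaussian measures, so in particular $\operatorname{ran}\mathcal{C}_{\mathrm{pos}}^{1/2}=\operatorname{ran}\mathcal{C}_{\mathrm{pr}}^{1/2}$. The inverses $\mathcal{C}^{-1/2}$ are defined on $\operatorname{ran}\mathcal{C}^{1/2}$; the operators $\mathcal{C}_{\mathrm{pr}}^{-1/2}\mathcal{C}_{\mathrm{pos}}^{1/2}$ and $\mathcal{C}_{\mathrm{pos}}^{-1/2}\mathcal{C}_{\mathrm{pr}}^{1/2}$ are bounded and invertible on $\mathcal{H}$. For positive trace-class $\mathcal{C}_1,\mathcal{C}_2$ for which $\mathcal{N}(0,\mathcal{C}_1)$ and $\mathcal{N}(0,\mathcal{C}_2)$ are equivalent, $R(\mathcal{C}_2\Vert\mathcal{C}_1):=(\mathcal{C}_1^{-1/2}\mathcal{C}_2^{1/2})(\mathcal{C}_1^{-1/2}\mathcal{C}_2^{1/2})^*-I\in L_2(\mathcal{H})_{\mathbb{R}}$. *)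

(* Defs.v *)
From HB Require Import structures.
From mathcomp Require Import all_boot all_order all_algebra.
From mathcomp Require Import all_classical all_reals all_analysis.

Set Implicit Arguments.
Unset Strict Implicit.
Unset Printing Implicit Defensive.

Import Order.TTheory GRing.Theory Num.Theory.
Import numFieldNormedType.Exports.

Local Open Scope classical_set_scope.
Local Open Scope ring_scope.

HB.mixin Record isInnerProduct (R : realType) V & GRing.Lmodule R V := {
  dot : V -> V -> R;
  dotC : forall x y, dot x y = dot y x;
  dotDl : forall x y z, dot (x + y) z = dot x z + dot y z;
  dotZl : forall a x y, dot (a *: x) y = a * dot x y;
  dot_gt0 : forall x, x != 0 -> 0 < dot x x
}.

#[short(type="innerProductType")]
HB.structure Definition InnerProduct (R : realType) :=
  {V of GRing.Lmodule R V & isInnerProduct R V}.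

HB.mixin Record InnerProduct_isHilbert (R : realType) V
    & CompleteNormedModule R V & InnerProduct R V := {
  dot_normE : forall x : V, dot x x = `|x| ^+ 2
}.

#[short(type="hilbertType")]
HB.structure Definition Hilbert (R : realType) :=
  {V of CompleteNormedModule R V & InnerProduct R V
    & InnerProduct_isHilbert R V}.

(* The library norm on ['cV[R]_n] is the sup norm, so this instance only equips
   R^n with its Euclidean inner product (hence with the right adjoints); both
   norms define the same topology and the same bounded operators. *)
Section EuclideanInnerProduct.
Variables (R : realType) (n : nat).

Definition cV_dot (x y : 'cV[R]_n) : R := \sum_i x i 0 * y i 0.

Lemma cV_dotC x y : cV_dot x y = cV_dot y x.
Proof. by apply: eq_bigr => i _; rewrite mulrC. Qed.

Lemma cV_dotDl x y z : cV_dot (x + y) z = cV_dot x z + cV_dot y z.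
Proof. by rewrite -big_split; apply: eq_bigr => i _; rewrite mxE mulrDl. Qed.

Lemma cV_dotZl a x y : cV_dot (a *: x) y = a * cV_dot x y.
Proof. by rewrite mulr_sumr; apply: eq_bigr => i _; rewrite mxE mulrA. Qed.

Lemma cV_dot_gt0 x : x != 0 -> 0 < cV_dot x x.
Proof.
have xx0 i : 0 <= x i 0 * x i 0 by rewrite -expr2 sqr_ge0.
have cge0 : 0 <= cV_dot x x by apply: sumr_ge0.
rewrite lt0r cge0 andbT; apply: contra_neq => /psumr_eq0P x0.
apply/colP => i; have /eqP := x0 (fun i _ => xx0 i) i isT.
by rewrite mulf_eq0 orbb mxE => /eqP.
Qed.

HB.instance Definition _ := isInnerProduct.Build R 'cV[R]_n
  cV_dotC cV_dotDl cV_dotZl cV_dot_gt0.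

End EuclideanInnerProduct.

Definition separable (T : topologicalType) :=
  exists2 D : set T, countable D & dense D.

Section LinearDimension.
Variables (R : realType) (V : lmodType R).

Definition lin_indep k (e : 'I_k -> V) :=
  forall a : 'I_k -> R, \sum_i a i *: e i = 0 -> forall i, a i = 0.

(* [lin_dim E] represents the dimension d in {0, 1, ..., oo} of the subspace E
   as the set of all k < d, that is {0, ..., d - 1}, or all of nat if d is
   infinite.  It thus serves both as an index set for bases and, through #=, as
   a cardinal. *)
Definition lin_dim (E : set V) : set nat :=
  [set k | exists2 e : 'I_k.+1 -> V, (forall i, E (e i)) & lin_indep e].

End LinearDimension.

Definition rank (R : realType) (U V : lmodType R) (T : U -> V) : set nat :=
  lin_dim (range T).

Definition bounded_op (R : realType) (U V : normedModType R) (T : U -> V) :=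
  linear T /\ continuous T.

(* Meaningful on [range T] for injective T; elsewhere the value is 0. *)
Definition opinv (R : realType) (U V : lmodType R) (T : U -> V) : V -> U :=
  fun y => xget 0 [set x | T x = y].

Section InnerProductOperators.
Variable R : realType.

Definition adjoint (U V : innerProductType R) (T : U -> V) : V -> U :=
  fun y => xget 0 [set x | forall u, dot (T u) y = dot u x].

Variable V : innerProductType R.

Definition self_adjoint (T : V -> V) := forall x y, dot (T x) y = dot x (T y).

Definition nonneg_op (T : V -> V) := forall h, h != 0 -> 0 <= dot (T h) h.

Definition positive_op (T : V -> V) := forall h, h != 0 -> 0 < dot (T h) h.

Definition tensor (k h : V) : V -> V := fun x => dot h x *: k.

End InnerProductOperators.

Section HilbertOperators.
Variables (R : realType) (H : hilbertType R).

Definition is_sqrtop (T S : H -> H) :=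
  [/\ bounded_op S, self_adjoint S, nonneg_op S & S \o S = T].

Definition sqrtop (T : H -> H) : H -> H := xget (fun _ : H => 0 : H) (is_sqrtop T).

Definition basis_idx : set nat := lin_dim [set: H].

Definition orthonormal_basis (e : nat -> H) :=
  (forall i j, basis_idx i -> basis_idx j -> dot (e i) (e j) = (i == j)%:R) /\
  dense [set h | exists N (a : nat -> R),
           h = \sum_(0 <= i < N | i \in basis_idx) a i *: e i].

(* The trace of |T| = (T^* T)^(1/2) does not depend on the basis. *)
Definition trace_class (T : H -> H) :=
  bounded_op T /\
  exists2 e : nat -> H, orthonormal_basis e &
    (\esum_(i in basis_idx) (dot (sqrtop (adjoint T \o T) (e i)) (e i))%:E
      < +oo)%E.

Definition ell2 (J : interval R) (lam : nat -> R) :=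
  (forall i, basis_idx i -> lam i \in J) /\
  (\esum_(i in basis_idx) (lam i ^+ 2)%:E < +oo)%E.

(* T = sum_i c_i e_i (x) e_i, with convergence in operator norm. *)
Definition diag_series (T : H -> H) (c : nat -> R) (e : nat -> H) :=
  forall eps : R, 0 < eps -> \forall N \near \oo, forall h : H,
    `|T h - \sum_(0 <= i < N | i \in basis_idx) c i *: tensor (e i) (e i) h|
      <= eps * `|h|.

Definition rdiv (C2 C1 : H -> H) : H -> H :=
  let A := opinv (sqrtop C1) \o sqrtop C2 in (A \o adjoint A) \- id.

Variable n : nat.
Implicit Types (G : H -> 'cV[R]_n) (Cobs : 'cV[R]_n -> 'cV[R]_n).

Definition hessian G Cobs : H -> H := adjoint G \o opinv Cobs \o G.

Definition posterior_cov G Cobs (Cpr : H -> H) : H -> H :=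
  Cpr \- (Cpr \o adjoint G \o opinv (Cobs \+ (G \o Cpr \o adjoint G))
            \o G \o Cpr).

End HilbertOperators.

Arguments basis_idx {R} H.
Arguments ell2 {R} H J lam.

(* Main.v *)
(* Write P = Cpr^(1/2) H Cpr^(1/2), a nonnegative operator which factors through
   R^n.  The Woodbury identity gives Cpos = Cpr^(1/2) (1 + P)^-1 Cpr^(1/2), so
   the norms |Cpos^(1/2) u| and |Cpr^(1/2) u| are equivalent and, by Douglas'
   lemma, A = Cpr^(-1/2) Cpos^(1/2) and B = Cpos^(-1/2) Cpr^(1/2) are bounded
   and inverse to each other, with A A^* = (1 + P)^-1 and B^* B = 1 + P.
   All expansions follow from the one of P, with eigenvalues mu_i and
   lambda_i = 1 / (1 + mu_i) - 1: indeed (1 + lambda_i) B w_i = A^* w_i.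
   The eigenvectors with mu_i > 0 lie in ran P, hence in ran Cpr^(1/2); running
   Gram-Schmidt from them along a dense sequence of ran Cpr^(1/2) completes them
   to a basis without leaving that range, and by orthogonality the added
   vectors lie in ker P. *)
Require Import Defs.
From HB Require Import structures.
From mathcomp Require Import all_boot all_order all_algebra.
From mathcomp Require Import all_classical all_reals all_analysis.
From mathcomp Require Import ring lra.

Set Implicit Arguments.
Unset Strict Implicit.
Unset Printing Implicit Defensive.

Import Order.TTheory GRing.Theory Num.Theory.
Import numFieldNormedType.Exports.

Local Open Scope classical_set_scope.
Local Open Scope ring_scope.

(** * Linear and bounded operators *)

(** One variational lemma, [riesz_extension], supplies the functional analysis: with S the identity
    it is Riesz representation and yields adjoints; with S a square root it yields Douglas'
    factorisation and the density of ran Cpr^(1/2).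

    What couples the two diagonalisations is B A = 1 together with A A^* = (1 + P)^-1, which gives B
    = A^* (1 + P). Hence Cpos^(1/2) H Cpos^(1/2) = A^* P A is diagonal along the vectors A^* w_i,
    which are multiples of the v_i.

    The delicate part is the kernel of P: in infinite dimension ran Cpr^(1/2) is only dense, and an
    arbitrary orthonormal basis of ker P may leave it. The nonzero eigenvalues are finitely many and
    can be listed first, in nonincreasing order of mu; then lambda is nondecreasing and completing
    the basis merely appends zeros. *)

Section LinearFunctions.
Variables (R : realType) (U V : lmodType R).
Implicit Type f : U -> V.

Lemma linear_pack f : linear f -> exists g : {linear U -> V}, f = g.
Proof.
move=> lf; pose m := GRing.isLinear.Build R U V _ f lf.
by pose g : {linear U -> V} := HB.pack f m; exists g.
Qed.

Lemma lin0 f : linear f -> f 0 = 0.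
Proof. by move=> /linear_pack[g ->]; rewrite linear0. Qed.

Lemma linD f : linear f -> {morph f : x y / x + y}.
Proof. by move=> /linear_pack[g ->] x y; rewrite linearD. Qed.

Lemma linB f : linear f -> {morph f : x y / x - y}.
Proof. by move=> /linear_pack[g ->] x y; rewrite linearB. Qed.

Lemma linZ f a : linear f -> {morph f : x / a *: x}.
Proof. by move=> /linear_pack[g ->] x; rewrite linearZ. Qed.

Lemma lin_sum f (I : Type) (s : seq I) (P : pred I) (F : I -> U) : linear f ->
  f (\sum_(i <- s | P i) F i) = \sum_(i <- s | P i) f (F i).
Proof. by move=> /linear_pack[g ->]; rewrite linear_sum. Qed.

Lemma linear_inj0 f : linear f -> (forall x, f x = 0 -> x = 0) -> injective f.
Proof.
move=> lf f0 x y fxy; apply/subr0_eq/f0.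
by rewrite linB // fxy subrr.
Qed.

Lemma linear_add f g : linear f -> linear g -> linear (f \+ g).
Proof. by move=> lf lg a x y /=; rewrite lf lg scalerDr addrACA. Qed.

Lemma linear_opp f : linear f -> linear (\- f).
Proof. by move=> lf a x y /=; rewrite lf opprD scalerN. Qed.

Lemma linear_sub f g : linear f -> linear g -> linear (f \- g).
Proof. by move=> lf lg; apply: linear_add => //; apply: linear_opp. Qed.

Lemma linear_scale c f : linear f -> linear (c \*: f).
Proof. by move=> lf a x y /=; rewrite lf scalerDr !scalerA mulrC. Qed.

End LinearFunctions.

Lemma linear_id (R : realType) (U : lmodType R) : linear (@idfun U).
Proof. by []. Qed.

Lemma linear_comp (R : realType) (U V W : lmodType R)
  (f : V -> W) (g : U -> V) : linear f -> linear g -> linear (f \o g).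
Proof. by move=> lf lg a x y /=; rewrite lg lf. Qed.

Lemma opinvK (R : realType) (U V : lmodType R) (T : U -> V) y :
  range T y -> T (opinv T y) = y.
Proof.
by move=> [x _ Txy]; apply: (@xgetPex _ 0 [set x | T x = y]); exists x.
Qed.

Lemma opinv_eq (R : realType) (U V : lmodType R) (T : U -> V) x y :
  injective T -> T x = y -> opinv T y = x.
Proof.
by move=> Tinj Txy; apply: Tinj; rewrite Txy opinvK //; exists x.
Qed.

Section BoundedOperators.
Variables (R : realType) (U V W : normedModType R).

Lemma bounded_opP (f : U -> V) : bounded_op f <->
  linear f /\ exists2 C : R, 0 <= C & forall x, `|f x| <= C * `|x|.
Proof.
split=> [[lf cf]|[lf [C C0 fC]]]; split=> //.
- have [g fg] := linear_pack lf; move: cf; rewrite fg => cg.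
  have /linear_boundedP[M [Mr gM]] := continuous_linear_bounded 0 (cg 0).
  pose C := Num.max 0 M + 1; exists C.
    by rewrite addr_ge0 // le_max lexx.
  by move=> x; apply: gM; rewrite /C ltr_pwDr // le_max lexx orbT.
- have [g fg] := linear_pack lf; rewrite fg; apply: bounded_linear_continuous.
  apply/linear_boundedP; exists C; split; first exact: num_real.
  move=> r Cr x; rewrite -fg (le_trans (fC x)) // ler_wpM2r //; exact: ltW.
Qed.

Lemma bounded_comp (f : V -> W) (g : U -> V) :
  bounded_op f -> bounded_op g -> bounded_op (f \o g).
Proof.
move=> [lf cf] [lg cg]; split; first exact: linear_comp.
by move=> x; apply: continuous_comp; [exact: cg|exact: cf].
Qed.

End BoundedOperators.

Lemma bounded_add (R : realType) (U V : normedModType R) (f g : U -> V) :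
  bounded_op f -> bounded_op g -> bounded_op (f \+ g).
Proof.
move=> [lf cf] [lg cg]; split; first exact: linear_add.
by move=> x; apply: cvgD; [exact: cf|exact: cg].
Qed.

Lemma bounded_sub (R : realType) (U V : normedModType R) (f g : U -> V) :
  bounded_op f -> bounded_op g -> bounded_op (f \- g).
Proof.
move=> [lf cf] [lg cg]; split; first exact: linear_sub.
by move=> x; apply: cvgB; [exact: cf|exact: cg].
Qed.

Lemma bounded_id (R : realType) (U : normedModType R) : bounded_op (@id U).
Proof. by split=> // x; exact: cvg_id. Qed.

(** * Inner products and limiting arguments *)

Section InnerProductTheory.
Variables (R : realType) (V : innerProductType R).
Implicit Types x y z : V.

Lemma dotDr x y z : dot x (y + z) = dot x y + dot x z.
Proof. by rewrite dotC dotDl !(dotC x). Qed.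

Lemma dotZr a x y : dot x (a *: y) = a * dot x y.
Proof. by rewrite dotC dotZl dotC. Qed.

Lemma dot_linear x : linear (dot x : V -> R^o).
Proof. by move=> a y z; rewrite dotDr dotZr. Qed.

Lemma dotNl x y : dot (- x) y = - dot x y.
Proof. by rewrite -scaleN1r dotZl mulN1r. Qed.

Lemma dotNr x y : dot x (- y) = - dot x y.
Proof. by rewrite dotC dotNl dotC. Qed.

Lemma dotBl x y z : dot (x - y) z = dot x z - dot y z.
Proof. by rewrite dotDl dotNl. Qed.

Lemma dotBr x y z : dot x (y - z) = dot x y - dot x z.
Proof. by rewrite dotDr dotNr. Qed.

Lemma dot0l x : dot 0 x = 0.
Proof. by rewrite -(scale0r 0) dotZl mul0r. Qed.

Lemma dot0r x : dot x 0 = 0.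
Proof. by rewrite dotC dot0l. Qed.

Lemma dot_sumr (I : Type) (s : seq I) (P : pred I) (F : I -> V) x :
  dot x (\sum_(i <- s | P i) F i) = \sum_(i <- s | P i) dot x (F i).
Proof. exact: (lin_sum _ _ _ (@dot_linear x)). Qed.

Lemma dot_ge0 x : 0 <= dot x x.
Proof. by have [->|/dot_gt0/ltW//] := eqVneq x 0; rewrite dot0l. Qed.

Lemma dot_eq0 x : dot x x = 0 -> x = 0.
Proof. by have [//|/dot_gt0 + x0] := eqVneq x 0; rewrite x0 ltxx. Qed.

Lemma dot_ext x y : (forall u, dot x u = dot y u) -> x = y.
Proof. by move=> xy; apply/subr0_eq/dot_eq0; rewrite dotBl xy subrr. Qed.

Lemma nonneg_op_ge0 (T : V -> V) : linear T -> nonneg_op T ->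
  forall h, 0 <= dot (T h) h.
Proof.
move=> lT T0 h; have [->|h0] := eqVneq h 0; last exact: T0.
by rewrite dot0r.
Qed.

End InnerProductTheory.

(** Evaluate at the minimiser t = -b / c. Besides Cauchy-Schwarz, this yields the first-order
    condition at approximate minimisers in [riesz_extension]. *)
Lemma quadratic_ge0 (R : realType) (a b c : R) : 0 <= c ->
  (forall t, 0 <= a + 2 * t * b + t ^+ 2 * c) -> b ^+ 2 <= a * c.
Proof.
move=> cge0 q.
have [c0|c0] := eqVneq c 0.
  have [->|b0] := eqVneq b 0; first by rewrite c0 mulr0 expr0n.
  (* For c = 0 the polynomial is affine in t; this t gives it the value -1. *)
  have := q (- (a + 1) / (2 * b)); rewrite c0 mulr0 addr0.
  have -> : a + 2 * (- (a + 1) / (2 * b)) * b = -1 by field.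
  by rewrite ler0N1.
have cgt0 : 0 < c by rewrite lt_neqAle eq_sym c0.
have := q (- b / c).
have -> : a + 2 * (- b / c) * b + (- b / c) ^+ 2 * c = a - b ^+ 2 / c by field.
by rewrite subr_ge0 ler_pdivrMr.
Qed.

(** The form in which identities pass to limits: M stays fixed while e shrinks. The case e = 1
    already forces M >= 0. *)
Lemma squeeze_norm0 (R : realType) (V : normedModType R) (x : V) (M : R) :
  (forall e, 0 < e -> `|x| <= e * M) -> x = 0.
Proof.
move=> xM; apply/eqP; rewrite -normr_le0; apply/ler_addgt0Pr => e e0.
have M0 : 0 <= M by have := xM 1 ltr01; rewrite mul1r; exact: le_trans.
have M1 : 0 < M + 1 by rewrite ltr_wpDl.
rewrite add0r (le_trans (xM (e / (M + 1)) _)) ?divr_gt0 //.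
by rewrite mulrAC ler_pdivrMr // ler_wpM2l ?(ltW e0) // lerDl.
Qed.

Lemma cauchy_limit (R : realType) (V : completeNormedModType R) (x : nat -> V) :
  (forall e, 0 < e ->
     exists N, forall k l, (N <= k)%N -> (N <= l)%N -> `|x k - x l| < e) ->
  exists z, forall e, 0 < e -> exists N, forall k, (N <= k)%N -> `|z - x k| < e.
Proof.
move=> cx.
have : cvg (x @ \oo).
  apply/cauchy_cvgP/cauchy_ballP => e e0.
  have [N cN] := cx e e0.
  exists ([set y | exists2 k, (N <= k)%N & y = x k],
          [set y | exists2 k, (N <= k)%N & y = x k]) => /=.
    by split; exists N => // k /= Nk; exists k.
  by move=> [_ _] /= [[k Nk ->] [l Nl ->]]; rewrite -ball_normE /=; exact: cN.
move=> /cvgrPdist_lt cvx; exists (lim (x @ \oo)) => e /cvx[N _ Ne].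
by exists N => k; exact: Ne.
Qed.

Lemma adjointP (R : realType) (U V : innerProductType R) (T : U -> V) :
  (forall y, exists z, forall u, dot (T u) y = dot u z) ->
  forall u y, dot (T u) y = dot u (adjoint T y).
Proof.
move=> ex u y.
exact: (@xgetPex _ 0 [set z | forall u, dot (T u) y = dot u z] (ex y)).
Qed.

(** * Riesz representation *)

Section HilbertGeometry.
Variables (R : realType) (H : hilbertType R).
Implicit Types (x y z h : H) (T : H -> H).

Lemma form_cauchy_schwarz T : linear T -> self_adjoint T -> nonneg_op T ->
  forall x y, dot (T x) y ^+ 2 <= dot (T x) x * dot (T y) y.
Proof.
move=> lT saT /(nonneg_op_ge0 lT) T0 x y; apply: quadratic_ge0 => // t.
have := T0 (x + t *: y).
rewrite (linD lT) (linZ _ lT) !(dotDl, dotDr, dotZl, dotZr).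
rewrite (saT y x) (dotC y); lra.
Qed.

Lemma cauchy_schwarz x y : `|dot x y| <= `|x| * `|y|.
Proof.
rewrite -(@ler_pXn2r _ 2) ?nnegrE ?mulr_ge0 //.
rewrite exprMn -!dot_normE real_normK ?num_real //.
by apply: (@form_cauchy_schwarz id) => // h /dot_gt0/ltW.
Qed.

(* [z] is the limit of [S u] along a sequence [u] minimising
   [|S u|^2 - 2 f u]. *)
Lemma riesz_extension (V : lmodType R) (S : V -> H) (f : V -> R^o) (C : R) :
  linear S -> linear f -> 0 <= C -> (forall u, `|f u| <= C * `|S u|) ->
  exists z, [/\ forall u, dot z (S u) = f u, `|z| <= C
    & forall e, 0 < e -> exists u, `|z - S u| < e].
Proof.
move=> lS lf C0 fC.
pose J u := dot (S u) (S u) - 2 * (f u : R).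
(* Completing the square in |S u|. *)
have JC u : - C ^+ 2 <= J u.
  rewrite /J dot_normE.
  have := fC u; rewrite ler_norml => /andP[_ fu].
  have := sqr_ge0 (`|S u| - C); nra.
have hJ : has_inf (range J).
  split; first by exists (J 0), 0.
  by exists (- C ^+ 2) => _ [u _ <-]; exact: JC.
pose m := inf (range J).
have Jm u : m <= J u by apply: ge_inf; [case: hJ|exists u].
pose d (k : nat) : R := k.+1%:R^-1.
have d0 k : 0 < d k by rewrite invr_gt0 ltr0n.
have dlt e : 0 < e -> exists N, forall k, (N <= k)%N -> d k < e.
  move=> e0; have [N _ Ne] := near_infty_natSinv_lt (PosNum e0).
  by exists N => k; exact: Ne.
have /choice[u uP] k : exists u, J u < m + d k ^+ 2.
  have [_ [u _ <-] Ju] := inf_adherent (exprn_gt0 2 (d0 k)) hJ.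
  by exists u.
(* J (u_k + t v) >= m for all t, while J (u_k) < m + d_k^2; the discriminant inequality then bounds
   the derivative of J at u_k. *)
have step k v : `|dot (S (u k)) (S v) - f v| <= d k * `|S v|.
  rewrite -(@ler_pXn2r _ 2) ?nnegrE ?mulr_ge0 ?(ltW (d0 k)) //.
  rewrite exprMn -!dot_normE real_normK ?num_real //.
  apply: quadratic_ge0; first exact: dot_ge0.
  move=> t; have := Jm (u k + t *: v); have := uP k.
  rewrite /J (linD lS) (linZ _ lS) (linD lf) (linZ _ lf).
  rewrite !(dotDl, dotDr, dotZl, dotZr).
  rewrite (dotC (S v)) /GRing.scale /=; lra.
(* Parallelogram law: the left side is 2 J v + 2 J w - 4 J ((v + w) / 2). Images of near-minimisers
   are therefore close to each other. *)
have par v w : dot (S v - S w) (S v - S w) <= 2 * J v + 2 * J w - 4 * m.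
  have := Jm (2^-1 *: v + 2^-1 *: w).
  rewrite /J (linD lf) !(linZ _ lf) (linD lS) !(linZ _ lS).
  rewrite !(dotBl, dotBr, dotDl, dotDr, dotZl, dotZr).
  rewrite (dotC (S w)) /GRing.scale /=; lra.
have [z zP] : exists z, forall e, 0 < e ->
    exists N, forall k, (N <= k)%N -> `|z - S (u k)| < e.
  apply: cauchy_limit => e e0; have [N Ne] := dlt (e / 4) (divr_gt0 e0 (ltr0n _ 4)).
  exists N => k l /Ne dk /Ne dl.
  rewrite -(@ltr_pXn2r _ 2) ?nnegrE ?(ltW e0) // -dot_normE.
  apply: le_lt_trans (par _ _) _.
  have := uP k; have := uP l; have := d0 k; have := d0 l; nra.
have zS v : dot z (S v) = f v.
  apply/subr0_eq/(@squeeze_norm0 _ R^o _ (2 * `|S v|)) => e e0.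
  have [N1 h1] := zP e e0; have [N2 h2] := dlt e e0.
  pose k := maxn N1 N2.
  have -> : dot z (S v) - f v
     = dot (z - S (u k)) (S v) + (dot (S (u k)) (S v) - f v).
    by rewrite dotBl addrA subrK.
  apply: le_trans (ler_normD _ _) _.
  have := cauchy_schwarz (z - S (u k)) (S v).
  have := step k v; have := h1 k (leq_maxl _ _); have := h2 k (leq_maxr _ _).
  have := normr_ge0 (S v); rewrite /k; nra.
have approx e : 0 < e -> exists u, `|z - S u| < e.
  by move=> e0; have [N h] := zP e e0; exists (u N); exact: h.
exists z; split => //.
(* For S v close to z, |z|^2 is close to <z, S v> = f v <= C |S v|. *)
have zz : `|z| ^+ 2 <= C * `|z|.
  apply/ler_addgt0Pr => e e0.
  have M0 : 0 < `|z| + C + 1 by rewrite ltr_wpDl // addr_ge0.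
  have [v zv] := approx (e / (`|z| + C + 1)) (divr_gt0 e0 M0).
  have -> : `|z| ^+ 2 = dot z (z - S v) + f v.
    by rewrite -dot_normE -zS -dotDr subrK.
  have Sv : `|S v| <= `|z| + `|z - S v|.
    by rewrite -{1}(subKr z (S v)) ler_normB.
  have := cauchy_schwarz z (z - S v); have := fC v.
  move: zv; rewrite ltr_pdivlMr // => zv.
  rewrite !ler_norml => /andP[_ fv] /andP[_ zzv].
  have := normr_ge0 z; have := normr_ge0 (z - S v); nra.
have [->//|z0] := eqVneq z 0; first by rewrite normr0.
by rewrite -(@ler_pM2r _ `|z|) ?normr_gt0.
Qed.

Lemma adjoint_bounded T : bounded_op T ->
  forall x y, dot (T x) y = dot x (adjoint T y).
Proof.
move=> /bounded_opP[lT [C C0 TC]]; apply: adjointP => y.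
have [||||z [zP _ _]] :=
    @riesz_extension H id (fun u => dot (T u) y) (C * `|y|).
- by [].
- by move=> a u v; rewrite lT dotDl dotZl.
- exact: mulr_ge0.
- move=> u; apply: le_trans (cauchy_schwarz _ _) _.
  by rewrite mulrAC ler_wpM2r.
- by exists z => u; rewrite -zP dotC.
Qed.

End HilbertGeometry.

(** * Square roots of nonnegative operators *)

Section SquareRoot.
Variables (R : realType) (H : hilbertType R).
Implicit Types (T : H -> H).

(** Cauchy-Schwarz for the form of T at x and T x gives |T x|^4 <= <T x, x> <T (T x), T x>, and the
    last factor is at most C |T x|^2. Thus a small quadratic form at x makes T x small. *)
Lemma bounded_nonneg_sq (T : H -> H) (C : R) :
  linear T -> self_adjoint T -> nonneg_op T -> 0 <= C ->
  (forall x, `|T x| <= C * `|x|) ->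
  forall x, `|T x| ^+ 2 <= C * dot (T x) x.
Proof.
move=> lT saT T0 C0 TC x.
have [->|Tx0] := eqVneq (T x) 0.
  by rewrite normr0 expr0n dot0l mulr0.
have nT : 0 < `|T x| ^+ 2 by rewrite exprn_gt0 // normr_gt0.
rewrite -(@ler_pM2r _ (`|T x| ^+ 2)) //.
have := form_cauchy_schwarz lT saT T0 x (T x).
rewrite dot_normE -expr2 => /le_trans; apply.
rewrite (mulrC C) -mulrA ler_wpM2l ?(nonneg_op_ge0 lT T0) //.
apply: le_trans (ler_norm _) _; apply: le_trans (cauchy_schwarz _ _) _.
by rewrite expr2 mulrA ler_wpM2r.
Qed.

Lemma contraction_of_nonneg (T : H -> H) (c : R) :
  linear T -> self_adjoint T -> nonneg_op T -> 0 < c ->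
  (forall x, `|T x| <= c * `|x|) -> forall x, `|x - c^-1 *: T x| <= `|x|.
Proof.
move=> lT saT T0 c0 Tc x.
have sq := bounded_nonneg_sq lT saT T0 (ltW c0) Tc x.
have Tx0 := nonneg_op_ge0 lT T0 x.
rewrite -(@ler_pXn2r _ 2) ?nnegrE // -!dot_normE.
rewrite !(dotBl, dotBr, dotZl, dotZr) (dotC x (T x)).
rewrite !dot_normE.
have -> : `|x| ^+ 2 - c^-1 * dot (T x) x -
  (c^-1 * dot (T x) x - c^-1 * (c^-1 * `|T x| ^+ 2)) =
  `|x| ^+ 2 - (2 * c * dot (T x) x - `|T x| ^+ 2) / c ^+ 2.
  by field; rewrite gt_eqF.
rewrite gerBl; apply: divr_ge0; last by rewrite exprn_ge0 // ltW.
rewrite subr_ge0; apply: le_trans sq _.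
by have := mulr_ge0 (ltW c0) Tx0; lra.
Qed.

(* The fixed point [Y = (X + Y^2) / 2] satisfies [(1 - Y)^2 = 1 - X]; its
   Picard iterates are dominated in norm by the scalar ones for [X = 1]. *)
Fixpoint sqrt_iter (X : H -> H) (k : nat) : H -> H :=
  if k is k.+1 then
    2^-1 \*: (X \+ (sqrt_iter X k \o sqrt_iter X k))
  else fun=> 0.

Fixpoint sqrt_majorant (k : nat) : R :=
  if k is k.+1 then 2^-1 * (1 + sqrt_majorant k ^+ 2) else 0.

Lemma sqrt_majorant_le1 k : 0 <= sqrt_majorant k <= 1.
Proof. by elim: k => [|k /= /andP[? ?]]; apply/andP; split => //=; nra. Qed.

Lemma sqrt_majorant_homo : {homo sqrt_majorant : k l / (k <= l)%N >-> k <= l}.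
Proof.
apply: homo_leq => // [x y z|k /=]; first exact: le_trans.
by have := sqr_ge0 (sqrt_majorant k - 1); lra.
Qed.

Lemma sqrt_majorant_cauchy e : 0 < e -> exists N, forall k l,
  (N <= k)%N -> (N <= l)%N -> `|sqrt_majorant k - sqrt_majorant l| < e.
Proof.
move=> e0; have hs : has_sup (range sqrt_majorant).
  split; first by exists 0, 0%N.
  by exists 1 => _ [k _ <-]; case/andP: (sqrt_majorant_le1 k).
have [_ [N _ <-] Ne] := sup_adherent e0 hs; exists N.
have ub k : sqrt_majorant k <= sup (range sqrt_majorant).
  by apply: ub_le_sup; [case: hs|exists k].
move=> k l /sqrt_majorant_homo Nk /sqrt_majorant_homo Nl.
by rewrite ltr_norml; have := ub k; have := ub l; lra.
Qed.

Section Contraction.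
Variable X : H -> H.
Hypotheses (lX : linear X) (saX : self_adjoint X)
  (X1 : forall x, `|X x| <= `|x|).
Local Notation Y := (sqrt_iter X).
Local Notation y := sqrt_majorant.

Lemma sqrt_iter_linear k : linear (Y k).
Proof.
elim: k => [|k IH] /=; first by move=> a u v; rewrite scaler0 addr0.
by apply/linear_scale/linear_add => //; exact: linear_comp.
Qed.

Lemma sqrt_iter_sa k : self_adjoint (Y k).
Proof.
elim: k => [|k IH] u v /=; first by rewrite dot0l dot0r.
by rewrite dotZl dotZr dotDl dotDr saX !IH.
Qed.

Lemma sqrt_iter_norm k x : `|Y k x| <= y k * `|x|.
Proof.
elim: k x => [|k IH] x /=; first by rewrite normr0 mul0r.
rewrite normrZ ger0_norm // -mulrA ler_wpM2l //.
apply: le_trans (ler_normD _ _) _; rewrite mulrDl mul1r lerD //.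
have /andP[yk _] := sqrt_majorant_le1 k.
by apply: le_trans (IH _) _; rewrite expr2 -mulrA ler_wpM2l.
Qed.

(** The splitting a^2 - b^2 = a (a - b) + (a - b) b holds for noncommuting operators. It is
    estimated term by term, and the majorant satisfies the same identity exactly. *)
Lemma sqrt_iter_step k x : `|Y k.+1 x - Y k x| <= (y k.+1 - y k) * `|x|.
Proof.
elim: k x => [|k IH] x.
  rewrite /= expr0n /= !subr0 !addr0 mulr1 normrZ ger0_norm // ler_wpM2l //.
set Y1 := Y k.+1 in IH *; set y1 := y k.+1 in IH *.
have lY1 : linear Y1 by exact: sqrt_iter_linear.
have -> : Y k.+2 x - Y1 x
    = 2^-1 *: (Y1 (Y1 x - Y k x) + (Y1 (Y k x) - Y k (Y k x))).
  by rewrite (linB lY1) addrA subrK {2}/Y1 /= -scalerBr opprD addrACA subrr add0r.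
have -> : y k.+2 - y1 = 2^-1 * (y1 * (y1 - y k) + (y1 - y k) * y k).
  have -> : y k.+2 = 2^-1 * (1 + y1 ^+ 2) by [].
  have : y1 = 2^-1 * (1 + y k ^+ 2) by [].
  by clear IH; move: y1 (y k) => a b; lra.
rewrite normrZ ger0_norm // -mulrA ler_wpM2l //.
apply: le_trans (ler_normD _ _) _; rewrite mulrDl; apply: lerD.
  have /andP[y10 _] := sqrt_majorant_le1 k.+1.
  by apply: le_trans (sqrt_iter_norm _ _) _; rewrite -mulrA ler_wpM2l.
apply: le_trans (IH _) _; rewrite -mulrA ler_wpM2l ?sqrt_iter_norm //.
by rewrite subr_ge0; exact: sqrt_majorant_homo.
Qed.

Lemma sqrt_iter_dist k l x : (k <= l)%N ->
  `|Y l x - Y k x| <= (y l - y k) * `|x|.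
Proof.
move=> /subnK <-; elim: (l - k)%N => [|j IH]; first by rewrite !subrr normr0 mul0r.
rewrite addSn -(subrK (Y (j + k) x) (Y _ x)) -addrA.
apply: le_trans (ler_normD _ _) _; apply: le_trans (lerD (sqrt_iter_step _ _) IH) _.
by rewrite -mulrDl addrA subrK.
Qed.

(** Completeness gives a pointwise limit; since the distances are controlled by the scalar sequence
    times |x|, the rate is uniform on bounded sets. *)
Lemma sqrt_iter_limit : exists Z : H -> H, forall e, 0 < e ->
  exists N, forall k x, (N <= k)%N -> `|Z x - Y k x| <= e * `|x|.
Proof.
have cau e x : 0 < e -> exists N, forall k l, (N <= k)%N -> (N <= l)%N ->
    `|Y k x - Y l x| < e.
  move=> e0; have x1 : 0 < `|x| + 1 by rewrite ltr_wpDl.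
  have [N Ne] := sqrt_majorant_cauchy (divr_gt0 e0 x1); exists N => k l Nk Nl.
  have Yy : `|Y k x - Y l x| <= `|y k - y l| * `|x|.
    have [kl|/ltnW lk] := leqP k l.
      by rewrite distrC (distrC (y k)) (le_trans (sqrt_iter_dist _ kl)) //
        ler_wpM2r // ler_norm.
    by rewrite (le_trans (sqrt_iter_dist _ lk)) // ler_wpM2r // ler_norm.
  apply: le_lt_trans Yy _.
  have := Ne _ _ Nk Nl; rewrite ltr_pdivlMr // mulrDr mulr1.
  by apply: le_lt_trans; rewrite lerDl.
have /choice[Z ZP] x : exists z, forall e, 0 < e ->
    exists N, forall k, (N <= k)%N -> `|z - Y k x| < e.
  by apply: cauchy_limit => e e0; exact: cau.
exists Z => e e0; have [N Ne] := sqrt_majorant_cauchy e0.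
exists N => k x Nk; apply/ler_addgt0Pr => e' e'0.
(* The intermediate index l depends on x and e', but the resulting bound does not. *)
have [N' N'e] := ZP x e' e'0; pose l := maxn k N'.
rewrite -(subrK (Y l x) (Z x)) -addrA addrC.
apply: le_trans (ler_normD _ _) _; apply: lerD.
  apply: le_trans (sqrt_iter_dist _ (leq_maxl _ _)) _.
  rewrite ler_wpM2r // (le_trans (ler_norm _)) // ltW //.
  by apply: Ne => //; rewrite (leq_trans Nk) ?leq_maxl.
by rewrite ltW //; apply: N'e; exact: leq_maxr.
Qed.

Lemma sqrt_fixpoint : exists Z : H -> H,
  [/\ linear Z, self_adjoint Z, forall x, `|Z x| <= `|x|
    & forall x, X x + Z (Z x) = 2 *: Z x].
Proof.
have [Z ZP] := sqrt_iter_limit; exists Z.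
have Z1 x : `|Z x| <= `|x|.
  apply/ler_addgt0Pr => e e0; have x1 : 0 < `|x| + 1 by rewrite ltr_wpDl.
  have [k /(_ k x (leqnn k)) Zk] := ZP _ (divr_gt0 e0 x1).
  rewrite -(subrK (Y k x) (Z x)) addrC; apply: le_trans (ler_normD _ _) _.
  apply: lerD.
    apply: le_trans (sqrt_iter_norm _ _) _.
    by rewrite ler_piMl //; case/andP: (sqrt_majorant_le1 k).
  apply: le_trans Zk _; rewrite mulrAC ler_pdivrMr // ler_wpM2l ?(ltW e0) //.
  by rewrite lerDl.
have lZ : linear Z.
  move=> a u v; apply/subr0_eq.
  apply: (@squeeze_norm0 _ _ _ (`|a *: u + v| + `|a| * `|u| + `|v|)) => e e0.
  have [k kZ] := ZP e e0; have Zk x := kZ k x (leqnn k).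
  have -> : Z (a *: u + v) - (a *: Z u + Z v) =
    (Z (a *: u + v) - Y k (a *: u + v)) - a *: (Z u - Y k u) - (Z v - Y k v).
    rewrite (sqrt_iter_linear k a u v).
    by apply: dot_ext => d; rewrite !(dotDl, dotNl, dotZl); ring.
  rewrite !mulrDr; apply: le_trans (ler_normB _ _) _; apply: lerD => //.
  apply: le_trans (ler_normB _ _) _; apply: lerD => //.
  by rewrite normrZ mulrCA ler_wpM2l.
split=> //.
- move=> u v; apply/subr0_eq/(@squeeze_norm0 _ R^o _ (2 * (`|u| * `|v|))) => e e0.
  have [k kZ] := ZP e e0; have Zk x := kZ k x (leqnn k).
  have -> : dot (Z u) v - dot u (Z v)
      = dot (Z u - Y k u) v - dot u (Z v - Y k v).
    by rewrite dotBl dotBr sqrt_iter_sa; lra.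
  apply: le_trans (ler_normB _ _) _.
  have := cauchy_schwarz (Z u - Y k u) v; have := cauchy_schwarz u (Z v - Y k v).
  have := Zk u; have := Zk v; have := normr_ge0 u; have := normr_ge0 v.
  nra.
- move=> x; apply/subr0_eq.
  apply: (@squeeze_norm0 _ _ _ (4 * `|x|)) => e e0.
  have [k Zk] := ZP e e0.
  (* The recursion for Y_(k+1) cancels X x and Y_k (Y_k x), leaving only approximation errors. *)
  have -> : X x + Z (Z x) - 2 *: Z x = (Z (Z x) - Y k (Z x)) +
      Y k (Z x - Y k x) - 2 *: (Z x - Y k.+1 x).
    rewrite (linB (sqrt_iter_linear k)) /=.
    by apply: dot_ext => d; rewrite !(dotBl, dotDl, dotZl); field.
  have -> : e * (4 * `|x|) = (e * `|x| + e * `|x|) + 2 * (e * `|x|) by ring.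
  apply: le_trans (ler_normB _ _) _; apply: lerD.
    apply: le_trans (ler_normD _ _) _; apply: lerD.
      by apply: le_trans (Zk k _ _) _ => //; rewrite ler_wpM2l // ltW.
    apply: le_trans (sqrt_iter_norm _ _) _; apply: le_trans (Zk k x _) => //.
    by rewrite ler_piMl //; case/andP: (sqrt_majorant_le1 k).
  by rewrite normrZ ger0_norm // ler_wpM2l // Zk.
Qed.

End Contraction.

Lemma sqrtop_exists (T : H -> H) :
  bounded_op T -> self_adjoint T -> nonneg_op T -> exists S, is_sqrtop T S.
Proof.
move=> /bounded_opP[lT [C C0 TC]] saT T0.
(* The added 1 makes c positive, so that T can be divided by it. *)
pose c := C + 1; have c0 : 0 < c by rewrite ltr_wpDl.
have Tc x : `|T x| <= c * `|x|.
  by apply: le_trans (TC x) _; rewrite ler_wpM2r // lerDl.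
pose X x := x - c^-1 *: T x.
have lX : linear X.
  by apply: linear_sub; [exact: linear_id|exact: linear_scale].
have saX : self_adjoint X.
  by move=> u v; rewrite /X dotBl dotBr dotZl dotZr saT.
have [Z [lZ saZ Z1 ZP]] :=
  sqrt_fixpoint lX saX (contraction_of_nonneg lT saT T0 c0 Tc).
pose s := Num.sqrt c; have s2 : s * s = c by rewrite -expr2 sqr_sqrtr // ltW.
(* X + Z^2 = 2 Z means (1 - Z)^2 = 1 - X = T / c; nonnegativity of 1 - Z comes from |Z x| <= |x|. *)
exists (fun x => s *: (x - Z x)); split.
- apply/bounded_opP; split.
    by apply: linear_scale; apply: linear_sub => //; exact: linear_id.
  exists (s * 2); first by rewrite mulr_ge0 // sqrtr_ge0.
  move=> x; rewrite normrZ ger0_norm ?sqrtr_ge0 // -mulrA ler_wpM2l ?sqrtr_ge0 //.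
  by apply: le_trans (ler_normB _ _) _; have := Z1 x; lra.
- by move=> u v; rewrite dotZl dotZr dotBl dotBr saZ.
- move=> x _; rewrite dotZl dotBl dot_normE mulr_ge0 ?sqrtr_ge0 // subr_ge0.
  apply: le_trans (ler_norm _) _; apply: le_trans (cauchy_schwarz _ _) _.
  by rewrite expr2 ler_wpM2r.
- apply/funext => x /=; rewrite (linZ _ lZ) -scalerBr scalerA s2 (linB lZ).
  have -> : x - Z x - (Z x - Z (Z x)) = c^-1 *: T x.
    have -> : c^-1 *: T x = x - X x by rewrite opprB addrC subrK.
    have -> : X x = 2 *: Z x - Z (Z x) by rewrite -ZP addrK.
    by apply: dot_ext => d; rewrite !(dotBl, dotZl); ring.
  by rewrite scalerA divff ?gt_eqF // scale1r.
Qed.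

Lemma sqrtopP (T : H -> H) : bounded_op T -> self_adjoint T -> nonneg_op T ->
  is_sqrtop T (sqrtop T).
Proof.
by move=> bT saT T0; exact: xgetPex (sqrtop_exists bT saT T0).
Qed.

End SquareRoot.

(** * Spectral decomposition of finite-rank operators *)

Section FiniteDimension.
Variables (R : realType).

Lemma cV_dependent n k (b : 'I_k -> 'cV[R]_n) : (n < k)%N ->
  exists2 a : 'I_k -> R, exists i, a i != 0 & \sum_i a i *: b i = 0.
Proof.
move=> nk; pose M := \matrix_(i, j) b i j 0.
have : kermx M != 0.
  rewrite kermx_eq0 /row_free neq_ltn (leq_ltn_trans (rank_leq_col M)) //.
move=> /rowV0Pn[u /sub_kermxP uM u0]; exists (u 0).
  by have /rV0Pn[i ui] := u0; exists i.
apply/colP => j; rewrite summxE; transitivity ((u *m M) 0 j).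
  by rewrite [RHS]mxE; apply: eq_bigr => i _; rewrite !mxE.
by rewrite uM !mxE.
Qed.

Lemma lin_indep_range_cV n k (V : lmodType R) (T : 'cV[R]_n -> V)
    (e : 'I_k -> V) :
  linear T -> (forall i, range T (e i)) -> lin_indep e -> (k <= n)%N.
Proof.
move=> lT eT indep.
have /choice[b eb] i : exists x, T x = e i by have [x _ <-] := eT i; exists x.
rewrite leqNgt; apply/negP => nk.
have [a [i ai] ab0] := cV_dependent b nk.
move/negP: ai; apply; apply/eqP/(indep a).
transitivity (T (\sum_j a j *: b j)); last by rewrite ab0 lin0.
rewrite (lin_sum _ _ _ lT); apply: eq_bigr => j _.
by rewrite (linZ _ lT) eb.
Qed.

Lemma cV_sum_delta n (b : 'cV[R]_n) : b = \sum_i b i 0 *: delta_mx i 0.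
Proof.
rewrite {1}(matrix_sum_delta b); apply: eq_bigr => i _.
by rewrite big_ord1.
Qed.

Lemma cV_linear_bounded n (V : normedModType R) (T : 'cV[R]_n -> V) :
  linear T -> bounded_op T.
Proof.
move=> lT; apply/bounded_opP; split=> //.
exists (\sum_i `|T (delta_mx i 0)|); first exact: sumr_ge0.
move=> b; rewrite {1}(cV_sum_delta b) (lin_sum _ _ _ lT) mulr_suml.
apply: le_trans (ler_norm_sum _ _ _) _; apply: ler_sum => i _.
rewrite (linZ _ lT) normrZ mulrC ler_wpM2l //.
rewrite [leRHS]/Num.Def.normr/= mx_normrE.
by apply/bigmax_geP; right; exists (i, 0).
Qed.

(** The n + 1 vectors y, f e_1, ..., f e_n are dependent. In a dependence relation y has a nonzero
    coefficient, since otherwise injectivity makes all the others vanish. *)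
Lemma cV_linear_surj n (f : 'cV[R]_n -> 'cV[R]_n) : linear f -> injective f ->
  forall y, range f y.
Proof.
move=> lf finj y.
pose b (i : 'I_n.+1) :=
  if unlift ord0 i is Some j then f (delta_mx j 0) else y.
have [a [i ai]] := cV_dependent b (ltnSn n).
rewrite big_ord_recl /b unlift_none.
under eq_bigr => j _ do rewrite liftK -(linZ _ lf).
rewrite -(lin_sum _ _ _ lf); set x := \sum_(j < n) _ => ayx.
have [a0|a0] := eqVneq (a ord0) 0.
  move: ayx; rewrite a0 scale0r add0r -(lin0 lf) => /finj x0.
  case: (unliftP ord0 i) ai => [j ->|->]; last by rewrite a0 eqxx.
  have := congr1 (fun v : 'cV_n => v j 0) x0.
  rewrite /x summxE (bigD1 j) //= big1 ?addr0 => [|k kj]; last first.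
    by rewrite !mxE eqxx andbT eq_sym (negbTE kj) mulr0.
  by rewrite !mxE !eqxx mulr1 => ->; rewrite eqxx.
exists (- (a ord0)^-1 *: x) => //.
apply: (scalerI a0); rewrite (linZ _ lf) scalerA mulrN divff // scaleN1r.
by apply/esym/eqP; rewrite -subr_eq0 opprK ayx.
Qed.

Lemma opinv_linear (U V : lmodType R) (f : U -> V) : linear f -> injective f ->
  (forall y, range f y) -> linear (opinv f).
Proof.
by move=> lf finj fsurj a u v; apply: (opinv_eq finj); rewrite lf !opinvK.
Qed.

End FiniteDimension.

Definition orthonormal (R : realType) (V : innerProductType R) (r : nat)
    (w : nat -> V) :=
  forall i j, (i < r)%N -> (j < r)%N -> dot (w i) (w j) = (i == j)%:R.

Definition cons_fun (T : Type) (x : T) (f : nat -> T) (i : nat) : T :=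
  if i is i'.+1 then f i' else x.

Section Orthonormal.
Variables (R : realType) (V : innerProductType R).

Lemma dot_orthonormal_sum r (w : nat -> V) (a : 'I_r -> R) (j : 'I_r) :
  orthonormal r w -> dot (w j) (\sum_(i < r) a i *: w i) = a j.
Proof.
move=> ow; rewrite dot_sumr (bigD1 j) //= dotZr ow // eqxx mulr1 big1 ?addr0 //.
move=> i ij; rewrite dotZr ow //.
by rewrite (_ : (j : nat) == i = false) ?mulr0 // eq_sym; exact/negbTE.
Qed.

Lemma orthonormal_lin_indep r (w : nat -> V) :
  orthonormal r w -> lin_indep (fun i : 'I_r => w i).
Proof.
by move=> ow a a0 i; rewrite -(dot_orthonormal_sum a i ow) a0 dot0r.
Qed.

Lemma orthonormal_cons r (x : V) w : dot x x = 1 ->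
  orthonormal r w -> (forall i, (i < r)%N -> dot x (w i) = 0) ->
  orthonormal r.+1 (cons_fun x w).
Proof.
move=> x1 ow xw [|i] [|j] //=; rewrite ltnS => ir jr; last exact: ow.
- exact: xw.
- by rewrite dotC; exact: xw.
Qed.

End Orthonormal.

Section FiniteRankSpectral.
Variables (R : realType) (H : hilbertType R) (n : nat) (T : 'cV[R]_n -> H).
Hypothesis lT : linear T.

(* The supremum [c] of the Rayleigh quotient of [T \o Phi] is an eigenvalue:
   otherwise the matrix [c - Phi \o T] is invertible, which bounds
   [c - T \o Phi] away from [0]. *)
Lemma top_eigenvector (Phi : H -> 'cV[R]_n) :
  bounded_op Phi -> self_adjoint (T \o Phi) -> nonneg_op (T \o Phi) ->
  (exists x, T (Phi x) != 0) ->
  exists w mu, [/\ 0 < mu, dot w w = 1, T (Phi w) = mu *: w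
    & forall x, dot (T (Phi x)) x <= mu * dot x x].
Proof.
move=> bPhi saP P0 [x1 Px1].
have lPhi : linear Phi by case: bPhi.
have lP : linear (T \o Phi) by exact: linear_comp.
have bT : bounded_op T := cV_linear_bounded lT.
have /bounded_opP[_ [C C0 PC]] := bounded_comp bT bPhi.
have dP0 := nonneg_op_ge0 lP P0.
pose E := [set dot (T (Phi x)) x / dot x x | x in [set x | x != 0]].
have x10 : x1 != 0.
  by apply: contra Px1 => /eqP ->; rewrite -[T _]/((T \o Phi) 0) (lin0 lP).
have hE : has_sup E.
  split; first by exists (dot (T (Phi x1)) x1 / dot x1 x1), x1.
  exists C => _ [x x0 <-]; rewrite ler_pdivrMr ?dot_gt0 //.
  apply: le_trans (ler_norm _) _; apply: le_trans (cauchy_schwarz _ _) _.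
  by rewrite dot_normE expr2 mulrA ler_wpM2r // PC.
pose c := sup E.
have cE x : dot (T (Phi x)) x <= c * dot x x.
  have [->|x0] := eqVneq x 0; first by rewrite !dot0r mulr0.
  by rewrite -ler_pdivrMr ?dot_gt0 // ub_le_sup //; [case: hE|exists x].
have c0 : 0 < c.
  have : 0 < C * dot (T (Phi x1)) x1.
    apply: lt_le_trans (bounded_nonneg_sq lP saP P0 C0 PC x1).
    by rewrite exprn_gt0 // normr_gt0.
  move=> Cd; have d0 : 0 < dot (T (Phi x1)) x1.
    rewrite lt0r (dP0 x1) andbT.
    by apply: contraTneq Cd => ->; rewrite mulr0 ltxx.
  by rewrite -(pmulr_lgt0 _ (dot_gt0 x1 x10)) (lt_le_trans d0).
pose g b := c *: b - Phi (T b).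
have lg : linear g.
  by apply: linear_sub; [exact: linear_scale|exact: linear_comp].
(* If Phi (T b) = c b with b nonzero, then T b is an eigenvector of T o Phi, and T b is nonzero
   because c > 0. *)
have [[b [b0 gb]]|ginj] := pselect (exists b, b != 0 /\ g b = 0).
  have Pw : T (Phi (T b)) = c *: T b.
    by rewrite -(linZ _ lT); congr T; move/eqP: gb; rewrite subr_eq0 => /eqP.
  have w0 : T b != 0.
    apply: contra b0 => /eqP Tb; move/eqP: gb.
    by rewrite /g Tb (lin0 lPhi) subr0 scaler_eq0 gt_eqF.
  have nw : `|T b| != 0 by rewrite normr_eq0.
  exists (`|T b|^-1 *: T b), c; split => //.
    by rewrite dotZl dotZr dot_normE; field.
  by rewrite -[LHS]/((T \o Phi) _) (linZ _ lP) /= Pw !scalerA mulrC.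
have {}ginj : injective g.
  apply: (linear_inj0 lg) => b gb; apply/eqP/negPn/negP => b0.
  by apply: ginj; exists b.
have gs := cV_linear_surj lg ginj.
have lpsi := opinv_linear lg ginj gs.
have /bounded_opP[_ [D D0 TD]] :=
  bounded_comp bT (bounded_comp (cV_linear_bounded lpsi) bPhi).
pose Q x := c *: x - T (Phi x).
have lQ : linear Q.
  by apply: linear_sub => //; apply: linear_scale; exact: linear_id.
have saQ : self_adjoint Q.
  by move=> x y; rewrite /Q dotBl dotBr dotZl dotZr; congr (_ - _); exact: saP.
have Q0 : nonneg_op Q by move=> x _; rewrite /Q dotBl dotZl subr_ge0.
have QC x : `|Q x| <= (c + C) * `|x|.
  apply: le_trans (ler_normB _ _) _.
  by rewrite normrZ gtr0_norm // mulrDl lerD // PC.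
(* Since g (Phi x) = Phi (Q x), the vector x is recovered from Q x: c x = Q x + T (g^-1 (Phi (Q
   x))). *)
have below x : c * `|x| <= (1 + D) * `|Q x|.
  have -> : c * `|x| = `|c *: x| by rewrite normrZ gtr0_norm.
  have -> : c *: x = Q x + T (opinv g (Phi (Q x))).
    have -> : opinv g (Phi (Q x)) = Phi x.
      by apply: opinv_eq => //; rewrite /Q (linB lPhi) (linZ _ lPhi).
    by rewrite subrK.
  by apply: le_trans (ler_normD _ _) _; rewrite mulrDl mul1r lerD // TD.
have cC0 : 0 <= c + C by rewrite addr_ge0 // ltW.
(* Combined with |Q x|^2 <= (c + C) <Q x, x>, this keeps every Rayleigh quotient at least c^2 / K
   below c, against the choice of c as supremum. *)
have gap x : c ^+ 2 * dot x x <=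
    ((1 + D) ^+ 2 * (c + C)) * (c * dot x x - dot (T (Phi x)) x).
  have := bounded_nonneg_sq lQ saQ Q0 cC0 QC x.
  rewrite /Q dotBl dotZl -/(Q x) => sq.
  rewrite dot_normE -exprMn -mulrA -dot_normE.
  apply: (@le_trans _ _ ((1 + D) ^+ 2 * `|Q x| ^+ 2)).
    rewrite -exprMn ler_pXn2r ?nnegrE ?mulr_ge0 ?addr_ge0 // ltW //.
  by rewrite ler_wpM2l // exprn_ge0 // addr_ge0.
set K := (1 + D) ^+ 2 * (c + C) in gap.
have K0 : 0 < K by rewrite mulr_gt0 ?exprn_gt0 ?ltr_pwDl // ltr_wpDr.
have k0 : 0 < c ^+ 2 / K by rewrite divr_gt0 // exprn_gt0.
have [_ [x x0 <-]] := sup_adherent k0 hE.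
rewrite -/c ltr_pdivlMr ?dot_gt0 // mulrBl mulrAC ltrBlDr -ltrBlDl.
rewrite ltr_pdivlMr // mulrC => /lt_le_trans /(_ (gap x)).
by rewrite ltxx.
Qed.

(* Deflation: splitting off a top eigenvector strictly decreases the bound [m]
   on the size of orthonormal families in the range. *)
Lemma spectral_deflation m (Phi : H -> 'cV[R]_n) :
  bounded_op Phi -> self_adjoint (T \o Phi) -> nonneg_op (T \o Phi) ->
  (forall w, orthonormal m w ->
     ~ (forall i, (i < m)%N -> range (T \o Phi) (w i))) ->
  exists r w mu, [/\ orthonormal r w, forall i, (i < r)%N -> 0 < mu i,
    forall i j, (i <= j)%N -> (j < r)%N -> mu j <= mu i
    & forall x, T (Phi x) = \sum_(i < r) (mu i * dot (w i) x) *: w i].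
Proof.
elim: m Phi => [|m IH] Phi bPhi saP P0 small.
  by case: (small (fun=> 0)).
have [[x Px]|P00] := pselect (exists x, T (Phi x) != 0); last first.
  exists 0%N, (fun=> 0), (fun=> 0); split=> // x.
  by rewrite big_ord0; apply: contra_notP P00 => /eqP; exists x.
have lPhi : linear Phi by case: bPhi.
have lP : linear (T \o Phi) by exact: linear_comp.
have [w0 [mu0 [mu00 w01 Pw0 Ptop]]] := top_eigenvector bPhi saP P0
  (ex_intro _ x Px).
(* Only Phi is deflated, so the new operator still factors through the same T. *)
pose Psi x := Phi x - dot w0 x *: Phi w0.
have TPsi y : T (Psi y) = T (Phi y) - (mu0 * dot w0 y) *: w0.
  by rewrite /Psi (linB lT) (linZ _ lT) Pw0 scalerA mulrC.
have Pw0E y : dot (T (Phi y)) w0 = mu0 * dot w0 y.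
  by rewrite (saP y w0) /= Pw0 dotZr dotC.
have perp y : dot w0 (T (Psi y)) = 0.
  by rewrite TPsi dotBr dotZr w01 dotC Pw0E mulr1 subrr.
have [||||r [w [mu [ow mu_gt0 mono PsiE]]]] := IH Psi.
- apply: bounded_sub => //; apply/bounded_opP; split.
    by move=> a u v; rewrite dotDr dotZr scalerDl scalerA.
  exists (`|w0| * `|Phi w0|); first exact: mulr_ge0.
  move=> y; rewrite normrZ mulrAC ler_wpM2r //; exact: cauchy_schwarz.
- move=> u v /=; rewrite !TPsi dotBl dotBr dotZl dotZr (saP u v) (dotC u w0) /=.
  ring.
(* Nonnegativity after deflation is Cauchy-Schwarz for the form of T o Phi at w0 and u, divided by
   mu0. *)
- move=> u _ /=; rewrite TPsi dotBl dotZl.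
  have := form_cauchy_schwarz lP saP P0 w0 u; rewrite /= Pw0 !dotZl w01.
  by rewrite exprMn mulr1 expr2 -mulrA ler_pM2l // subr_ge0 -mulrA -expr2.
(* Prefixing w0 to a family of length m in the deflated range gives one of length m + 1 in the
   original range. *)
- move=> w ow wP; apply: (small (cons_fun w0 w)).
    apply: orthonormal_cons => // i /wP[y _ <-]; exact: perp.
  move=> [|i]; rewrite ?ltnS => im.
    by exists (mu0^-1 *: w0); rewrite //= -[LHS]/((T \o Phi) _) (linZ _ lP) /=
      Pw0 scalerA mulVf ?scale1r // gt_eqF.
  have [y _ wy] := wP _ im; exists (y - dot w0 y *: w0) => //.
  by rewrite /= (linB lPhi) (linZ _ lPhi) -wy.
have eig i : (i < r)%N -> T (Psi (w i)) = mu i *: w i.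
  move=> ir; rewrite PsiE (bigD1 (Ordinal ir)) //= ow // eqxx mulr1.
  rewrite big1 ?addr0 // => j ji; rewrite ow //.
  by rewrite -[_ == _]/(j == Ordinal ir) (negbTE ji) mulr0 scale0r.
(* As mu i > 0, the vector w i lies in the range of T o Psi, which is orthogonal to w0. *)
have w0w i : (i < r)%N -> dot w0 (w i) = 0.
  move=> ir; have := perp (w i); rewrite eig // dotZr => /eqP.
  by rewrite mulf_eq0 gt_eqF ?mu_gt0 //= => /eqP.
have mu0_top i : (i < r)%N -> mu i <= mu0.
  move=> ir; have := Ptop (w i); rewrite ow // eqxx mulr1; apply: le_trans.
  have := TPsi (w i); rewrite w0w // mulr0 scale0r subr0 => <-.
  by rewrite eig // dotZl ow // eqxx mulr1.
exists r.+1, (cons_fun w0 w), (cons_fun mu0 mu); split.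
- exact: orthonormal_cons.
- by move=> [|i] //=; exact: mu_gt0.
- move=> [|i] [|j] //=; first by move=> _; exact: mu0_top.
  by rewrite !ltnS; exact: mono.
- move=> y; rewrite big_ord_recl /= -PsiE TPsi.
  by rewrite addrC subrK.
Qed.

Lemma finite_rank_spectral (Phi : H -> 'cV[R]_n) :
  bounded_op Phi -> self_adjoint (T \o Phi) -> nonneg_op (T \o Phi) ->
  exists r w mu, [/\ orthonormal r w, forall i, (i < r)%N -> 0 < mu i,
    forall i j, (i <= j)%N -> (j < r)%N -> mu j <= mu i
    & forall x, T (Phi x) = \sum_(i < r) (mu i * dot (w i) x) *: w i].
Proof.
move=> bPhi saP P0; apply: (@spectral_deflation n.+1) => // w ow wP.
suff : (n.+1 <= n)%N by rewrite ltnn.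
apply: (lin_indep_range_cV lT _ (orthonormal_lin_indep ow)) => i.
by have [x _ <-] := wP _ (ltn_ord i); exists (Phi x).
Qed.

End FiniteRankSpectral.

(** * Factorisation of operators *)

Section Douglas.
Variables (R : realType) (H : hilbertType R).
Implicit Types S T : H -> H.

(** For fixed h, the functional <T h, u> = <h, T u> is bounded by C |h| |S u|, so [riesz_extension]
    represents it as <z, S u>; this says S z = T h with |z| <= C |h|. The last claim is the adjoint
    of S o D = T, where D = S^-1 T. *)
Lemma douglas S T (C : R) : linear S -> self_adjoint S -> injective S ->
  linear T -> self_adjoint T -> 0 <= C -> (forall u, `|T u| <= C * `|S u|) ->
  [/\ bounded_op (opinv S \o T), forall x, S (opinv S (T x)) = T x
    & forall u, adjoint (opinv S \o T) (S u) = T u].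
Proof.
move=> lS saS Sinj lT saT C0 TS.
have ex h : exists z, S z = T h /\ `|z| <= C * `|h|.
  have [|||z [zS zC _]] := @riesz_extension _ _ H S (fun u => dot (T h) u)
    (C * `|h|) lS.
  - exact: dot_linear.
  - exact: mulr_ge0.
  - move=> u; rewrite saT mulrAC mulrC; apply: le_trans (cauchy_schwarz _ _) _.
    by rewrite ler_wpM2l.
  - exists z; split=> //; apply: dot_ext => u; rewrite saS; exact: zS.
have SD h : S (opinv S (T h)) = T h.
  by apply: opinvK; have [z [zT _]] := ex h; exists z.
have bD : bounded_op (opinv S \o T).
  apply/bounded_opP; split.
    by move=> a u v /=; apply: opinv_eq => //; rewrite lS !SD lT.
  exists C => // h; have [z [zT zC]] := ex h.
  by rewrite /= (opinv_eq Sinj zT).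
split=> // u; apply: dot_ext => v.
by rewrite dotC -adjoint_bounded //= -saS SD saT dotC.
Qed.

(** Representing u -> <x, S u> gives z in the closure of the range with x - z orthogonal to it. Then
    S (x - z) = 0, so z = x. *)
Lemma dense_range_sa S (x : H) (e : R) : linear S -> self_adjoint S ->
  injective S -> 0 < e -> exists u, `|x - S u| < e.
Proof.
move=> lS saS Sinj e0.
have [|||z [zS _ ze]] := @riesz_extension _ _ H S (fun u => dot x (S u)) `|x| lS.
- by move=> a u v; rewrite lS dotDr dotZr.
- by [].
- by move=> u; exact: cauchy_schwarz.
have -> : x = z.
  by apply: Sinj; apply: dot_ext => u; rewrite !saS zS.
exact: ze.
Qed.

End Douglas.

(** * Orthonormal bases inside a dense range *)

Section DenseSequences.
Variables (R : realType) (V : normedModType R).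

Lemma denseP (D : set V) :
  dense D <-> forall x e, 0 < e -> exists2 y, D y & `|x - y| < e.
Proof.
split=> [dD x e e0|dD O [x Ox] openO].
  have [||y [xy Dy]] := dD (ball x e); last 1 first.
  - by exists y => //; move: xy; rewrite -ball_normE.
  - by exists x; exact: ballxx.
  - exact: ball_open.
have /nbhs_ballP[e /= e0 xO] := open_nbhs_nbhs (conj openO Ox).
have [y Dy xy] := dD x e e0.
by exists y; split=> //; apply: xO; rewrite -ball_normE.
Qed.

Lemma separable_sequence : separable V ->
  exists d : nat -> V, forall x e, 0 < e -> exists k, `|x - d k| < e.
Proof.
move=> [D /countable_injP[f finj] /denseP dD].
(* Indices outside the image of f give the default 0, which does not harm density. *)
exists (fun k => xget 0 [set x | D x /\ f x = k]) => x e e0.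
have [y Dy xy] := dD x e e0; exists (f y).
case: xgetP => [z _ [Dz fz]|/(_ y)]; last by case.
by have -> : z = y by apply: finj => //; rewrite inE.
Qed.

End DenseSequences.

Section GramSchmidt.
Variables (R : realType) (H : hilbertType R).
Implicit Types (l : seq H) (x y : H).

Definition residual l x : H := x - \sum_(i < size l) dot l`_i x *: l`_i.

Lemma dot_residual l x i : orthonormal (size l) (nth 0 l) -> (i < size l)%N ->
  dot l`_i (residual l x) = 0.
Proof.
move=> ol il; rewrite /residual dotBr.
by rewrite (dot_orthonormal_sum _ (Ordinal il) ol) subrr.
Qed.

Lemma orthonormal_rcons l y : orthonormal (size l) (nth 0 l) -> dot y y = 1 ->
  (forall i, (i < size l)%N -> dot l`_i y = 0) ->
  orthonormal (size (rcons l y)) (nth 0 (rcons l y)).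
Proof.
move=> ol y1 ly i j; rewrite size_rcons !ltnS !nth_rcons.
rewrite leq_eqVlt => /predU1P[->|il]; rewrite leq_eqVlt => /predU1P[->|jl].
- by rewrite ltnn !eqxx.
- by rewrite ltnn eqxx jl dotC ly // gtn_eqF.
- by rewrite ltnn eqxx il ly // ltn_eqF.
- by rewrite il jl ol.
Qed.

Variables (U : lmodType R) (S : U -> H) (d : nat -> U) (r : nat) (w0 : nat -> H).
Hypotheses (lS : linear S) (ow0 : orthonormal r w0)
  (w0S : forall i, (i < r)%N -> range S (w0 i))
  (dS : forall x e, 0 < e -> exists k, `|x - S (d k)| < e).

(** Lists grow only at the end, so an entry is final once present and the given w0 stay in front. A
    vector already in the span is skipped. *)
Fixpoint gram_schmidt k : seq H :=
  if k is k.+1 then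
    let l := gram_schmidt k in
    let y := residual l (S (d k)) in
    if y == 0 then l else rcons l (`|y|^-1 *: y)
  else mkseq w0 r.
Local Notation gs := gram_schmidt.

Lemma gram_schmidt_orthonormal k : orthonormal (size (gs k)) (nth 0 (gs k)).
Proof.
elim: k => [|k IH] /=.
  by move=> i j; rewrite size_mkseq => ir jr; rewrite !nth_mkseq // ow0.
set y := residual _ _; case: eqVneq => // y0; apply: orthonormal_rcons => //.
  by rewrite dotZl dotZr dot_normE; field; rewrite normr_eq0.
by move=> i il; rewrite dotZr dot_residual ?mulr0.
Qed.

Lemma gram_schmidt_range k i : (i < size (gs k))%N -> range S (gs k)`_i.
Proof.
elim: k i => [|k IH] i /=.
  by rewrite size_mkseq => ir; rewrite nth_mkseq //; exact: w0S.
set y := residual _ _; case: eqVneq => // y0; first exact: IH.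
rewrite size_rcons ltnS nth_rcons leq_eqVlt => /predU1P[->|il]; last first.
  by rewrite il; exact: IH.
rewrite ltnn eqxx.
have /choice[u uP] (j : 'I_(size (gs k))) : exists u, S u = (gs k)`_j.
  by have [u _ <-] := IH _ (ltn_ord j); exists u.
pose c (j : 'I_(size (gs k))) := dot (gs k)`_j (S (d k)).
exists (`|y|^-1 *: (d k - \sum_j c j *: u j)) => //.
rewrite (linZ _ lS) (linB lS) (lin_sum _ _ _ lS); congr (_ *: (_ - _)).
by apply: eq_bigr => j _; rewrite (linZ _ lS) uP.
Qed.

Lemma gram_schmidt_prefix (k l : nat) : (k <= l)%N -> prefix (gs k) (gs l).
Proof.
move=> /subnK <-; elim: (l - k)%N => [|j IH]; first exact: prefix_refl.
rewrite addSn /=; case: eqP => // _.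
by apply: prefix_trans IH _; exact: prefix_rcons.
Qed.

Lemma gram_schmidt_nth (k l i : nat) : (i < size (gs k))%N -> (i < size (gs l))%N ->
  (gs k)`_i = (gs l)`_i.
Proof.
wlog kl : k l / (k <= l)%N.
  by move=> th ik il; case/orP: (leq_total k l) => ?; [|apply/esym]; exact: th.
by move=> ik _; have /prefixP[s ->] := gram_schmidt_prefix kl; rewrite nth_cat ik.
Qed.

Lemma gram_schmidt_span k : S (d k) =
  \sum_(i < size (gs k.+1)) dot (gs k.+1)`_i (S (d k)) *: (gs k.+1)`_i.
Proof.
have ol := @gram_schmidt_orthonormal k.
rewrite /=; set y := residual _ _; case: eqVneq => y0.
  by apply/subr0_eq.
rewrite size_rcons big_ord_recr /= nth_rcons ltnn eqxx.
have yS : dot y (S (d k)) = `|y| ^+ 2.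
  rewrite -dot_normE {3}/y /residual dotBr dot_sumr big1 ?subr0 // => i _.
  by rewrite dotZr (dotC y) dot_residual // mulr0.
rewrite dotZl yS scalerA (_ : _ * _ = 1); last by field; rewrite normr_eq0.
rewrite scale1r.
rewrite -[LHS](subrK (\sum_(i < size (gs k))
  dot (gs k)`_i (S (d k)) *: (gs k)`_i)).
rewrite -/(residual (gs k) (S (d k))) -/y addrC; congr (_ + _).
by apply: eq_bigr => i _; rewrite nth_rcons ltn_ord.
Qed.

(** If no list exceeds length i, a longest one spans every S (d k). A residual against it is
    orthogonal to a dense sequence, hence zero, so the list spans the space and cannot leave room
    for i + 1 independent vectors. Finite and infinite dimension are thus treated alike. *)
Lemma basis_idx_gram_schmidt i : basis_idx H i <-> exists k, (i < size (gs k))%N.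
Proof.
split=> [Ii|[k ik]]; last first.
  exists (fun j : 'I_i.+1 => (gs k)`_j) => //.
  apply: (@orthonormal_lin_indep _ _ i.+1 (nth 0 (gs k))) => a b ai bi.
  by apply: gram_schmidt_orthonormal; exact: leq_trans ik.
apply: contrapT => small.
have bnd k : (size (gs k) <= i)%N.
  by rewrite leqNgt; apply/negP => ik; apply: small; exists k.
pose P m := `[< exists k, size (gs k) = m >].
have exP : exists m, P m by exists (size (gs 0)); apply/asboolP; exists 0%N.
have ubP m : P m -> (m <= i)%N by move=> /asboolP[k <-].
have [_ /asboolP[K <-] Kmax] := ex_maxnP exP ubP.
have maxK k : (size (gs k) <= size (gs K))%N.
  by apply: Kmax; apply/asboolP; exists k.
pose T (c : 'cV[R]_(size (gs K))) := \sum_(j < size (gs K)) c j 0 *: (gs K)`_j.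
have lT : linear T.
  move=> a b c; rewrite /T scaler_sumr -big_split; apply: eq_bigr => j _ /=.
  by rewrite !mxE scalerDl scalerA.
have [e _ indep] := Ii; suff : (i.+1 <= size (gs K))%N.
  by move=> /leq_trans/(_ (bnd K)); rewrite ltnn.
apply: (lin_indep_range_cV lT _ indep) => j.
exists (\col_m dot (gs K)`_m (e j)) => //; apply/esym/subr0_eq.
rewrite /T; under eq_bigr do rewrite mxE.
rewrite -/(residual (gs K) (e j)); set y := residual _ _.
have yd k : dot y (S (d k)) = 0.
  rewrite gram_schmidt_span dot_sumr big1 // => m _.
  have mK : (m < size (gs K))%N by exact: leq_trans (maxK k.+1).
  rewrite dotZr (gram_schmidt_nth (ltn_ord m) mK) (dotC y) dot_residual ?mulr0 //.
  exact: gram_schmidt_orthonormal.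
move: y yd => y yd; apply: (@squeeze_norm0 _ _ _ 1) => e1 e10; rewrite mulr1.
have [k /ltW] := dS y e10; apply: le_trans.
rewrite -(@ler_pXn2r _ 2) ?nnegrE // -!dot_normE dotBl !dotBr (dotC (S (d k)) y) !yd.
by rewrite subr0 sub0r opprK lerDl dot_ge0.
Qed.

Lemma orthonormal_basis_extension : exists w : nat -> H,
  [/\ orthonormal_basis w, forall i, (i < r)%N -> w i = w0 i,
    forall i, (i < r)%N -> basis_idx H i
    & forall i, basis_idx H i -> range S (w i)].
Proof.
(* Any list long enough gives the same entry, so the choice of k is immaterial. *)
pose w i := (gs (xget 0%N [set k | (i < size (gs k))%N]))`_i.
have wE k i : (i < size (gs k))%N -> w i = (gs k)`_i.
  move=> ik; apply: gram_schmidt_nth => //.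
  by apply: (@xgetPex _ _ [set k | (i < size (gs k))%N]); exists k.
exists w; split.
- split=> [i j /basis_idx_gram_schmidt[k ik] /basis_idx_gram_schmidt[l jl]|].
    have sz m : (m <= maxn k l)%N -> (size (gs m) <= size (gs (maxn k l)))%N.
      by move=> /gram_schmidt_prefix/prefixP[s ->]; rewrite size_cat leq_addr.
    have ikl := leq_trans ik (sz k (leq_maxl _ _)).
    have jkl := leq_trans jl (sz l (leq_maxr _ _)).
    by rewrite !(wE (maxn k l)) // gram_schmidt_orthonormal.
  apply/denseP => x e e0; have [k xk] := dS x e0; exists (S (d k)) => //.
  exists (size (gs k.+1)), (fun i => dot (w i) (S (d k))).
  rewrite {1}gram_schmidt_span [RHS]big_mkcond [RHS]big_mkord; apply: eq_bigr => i _.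
  rewrite ifT ?(wE k.+1) //; apply: mem_set.
  by apply/basis_idx_gram_schmidt; exists k.+1.
- by move=> i ir; rewrite (wE 0%N) ?size_mkseq //= nth_mkseq.
- by move=> i ir; apply/basis_idx_gram_schmidt; exists 0%N; rewrite size_mkseq.
- move=> i /basis_idx_gram_schmidt[k ik]; rewrite (wE k) //.
  exact: gram_schmidt_range.
Qed.

End GramSchmidt.

(** * The posterior covariance *)

Section AdjointTheory.
Variables (R : realType) (H : hilbertType R).

Lemma adjoint_linear (U V : innerProductType R) (T : U -> V) :
  (forall u y, dot (T u) y = dot u (adjoint T y)) -> linear (adjoint T).
Proof.
move=> adjT a x y; apply: dot_ext => u.
by rewrite dotC -adjT !(dotDl, dotDr, dotZl, dotZr) !adjT !(dotC _ u).
Qed.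

(** R^n carries the sup norm here, so <G u, y> is bounded coordinatewise, with constant C times the
    sum of the |y_i|. *)
Lemma adjoint_cVP n (G : H -> 'cV[R]_n) : bounded_op G ->
  forall u y, dot (G u) y = dot u (adjoint G y).
Proof.
move=> /bounded_opP[lG [C C0 GC]]; apply: adjointP => y.
have [||||z [zP _ _]] := @riesz_extension _ _ H id (fun u => dot (G u) y)
  (C * \sum_i `|y i 0|).
- by [].
- by move=> a u v; rewrite lG dotDl dotZl.
- by rewrite mulr_ge0 // sumr_ge0.
- move=> u; rewrite mulrAC mulr_sumr.
  apply: le_trans (ler_norm_sum _ _ _) _; apply: ler_sum => i _.
  rewrite normrM ler_wpM2r //; apply: le_trans (GC u).
  rewrite [leRHS]/Num.Def.normr/= mx_normrE.
  by apply/bigmax_geP; right; exists (i, 0).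
- by exists z => u; rewrite -zP dotC.
Qed.

Lemma positive_op_inj (V : innerProductType R) (T : V -> V) :
  linear T -> positive_op T -> injective T.
Proof.
move=> lT T0; apply: (linear_inj0 lT) => x Tx.
by apply/eqP/negPn/negP => /T0; rewrite Tx dot0l ltxx.
Qed.

Lemma positive_op_nonneg (V : innerProductType R) (T : V -> V) :
  positive_op T -> nonneg_op T.
Proof. by move=> T0 h /T0/ltW. Qed.

Lemma sqrtop_inj (T S : H -> H) : is_sqrtop T S -> injective T -> injective S.
Proof. by move=> [_ _ _ <-] Tinj x y Sxy; apply: Tinj; rewrite /= Sxy. Qed.

End AdjointTheory.

Section Posterior.
Variables (R : realType) (H : hilbertType R) (n : nat).
Variables (G : H -> 'cV[R]_n) (Cobs : 'cV[R]_n -> 'cV[R]_n) (Cpr : H -> H).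
Hypotheses (bG : bounded_op G) (bCobs : bounded_op Cobs)
  (saCobs : self_adjoint Cobs) (Cobs0 : positive_op Cobs)
  (bCpr : bounded_op Cpr) (saCpr : self_adjoint Cpr) (Cpr0 : positive_op Cpr).

Local Notation Gs := (adjoint G).
Local Notation Hop := (hessian G Cobs).
Local Notation Cpos := (posterior_cov G Cobs Cpr).
Local Notation Spr := (sqrtop Cpr).
Local Notation Spos := (sqrtop Cpos).
Local Notation M := (Cobs \+ (G \o Cpr \o Gs)).
Local Notation A := (opinv Spr \o Spos).
Local Notation B := (opinv Spos \o Spr).

Let adjG := adjoint_cVP bG.
Let lG : linear G := proj1 bG.
Let lGs : linear Gs := adjoint_linear adjG.
Let lCobs : linear Cobs := proj1 bCobs.
Let lCpr : linear Cpr := proj1 bCpr.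

Lemma prior_sqrt : is_sqrtop Cpr Spr.
Proof. exact: (sqrtopP bCpr saCpr (positive_op_nonneg Cpr0)). Qed.

Let bSpr : bounded_op Spr. Proof. by have [] := prior_sqrt. Qed.
Let lSpr : linear Spr := proj1 bSpr.
Let saSpr : self_adjoint Spr. Proof. by have [] := prior_sqrt. Qed.
Let SprE x : Spr (Spr x) = Cpr x.
Proof. by have [_ _ _ /(congr1 (@^~ x))] := prior_sqrt. Qed.

Lemma prior_sqrt_inj : injective Spr.
Proof. exact: sqrtop_inj prior_sqrt (positive_op_inj lCpr Cpr0). Qed.

Let lM : linear M.
Proof. by apply: linear_add => //; do 2![apply: linear_comp => //]. Qed.

Let M0 : positive_op M.
Proof.
move=> y y0 /=; rewrite dotDl adjG ltr_wpDr ?Cobs0 //.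
exact: nonneg_op_ge0 lCpr (positive_op_nonneg Cpr0) _.
Qed.

Let Minj : injective M := positive_op_inj lM M0.
Let MK y : M (opinv M y) = y := opinvK (cV_linear_surj lM Minj y).
Let lMi : linear (opinv M) := opinv_linear lM Minj (cV_linear_surj lM Minj).
Let Cinj : injective Cobs := positive_op_inj lCobs Cobs0.
Let CK y : Cobs (opinv Cobs y) = y := opinvK (cV_linear_surj lCobs Cinj y).
Let lCi : linear (opinv Cobs) :=
  opinv_linear lCobs Cinj (cV_linear_surj lCobs Cinj).

(** The inner factor of P = [T] o [obs_map] through R^n, to which the finite-rank spectral lemma
    applies. *)
Definition obs_map (x : H) : 'cV[R]_n := opinv Cobs (G (Spr x)).
Local Notation T := (Spr \o Gs).
Local Notation P := (Spr \o Hop \o Spr).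
Definition precond_posterior (x : H) : H := x - Spr (Gs (opinv M (G (Spr x)))).
Local Notation K := precond_posterior.

Lemma precond_factor_linear : linear T.
Proof. exact: linear_comp. Qed.

Lemma obs_map_bounded : bounded_op obs_map.
Proof.
apply: bounded_comp (cV_linear_bounded lCi) _.
exact: bounded_comp bG bSpr.
Qed.

Let bP : bounded_op P.
Proof.
exact: bounded_comp (cV_linear_bounded precond_factor_linear) obs_map_bounded.
Qed.
Let lP : linear P := proj1 bP.

Lemma hessian_linear : linear Hop.
Proof. exact: (linear_comp (linear_comp lGs lCi) lG). Qed.

Lemma hessian_sa : self_adjoint Hop.
Proof.
move=> x y /=; rewrite /hessian /= dotC -!adjG.
by rewrite -{1}(CK (G y)) saCobs CK dotC.
Qed.

Lemma precond_hessian_sa : self_adjoint P.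
Proof. by move=> x y /=; rewrite saSpr hessian_sa saSpr. Qed.

Lemma precond_hessian_nonneg : nonneg_op P.
Proof.
move=> x _ /=; rewrite saSpr /hessian /= dotC -adjG -{1}(CK (G (Spr x))).
exact: nonneg_op_ge0 lCobs (positive_op_nonneg Cobs0) _.
Qed.

(* Woodbury: [K] is the inverse of [1 + P]. *)
Lemma precond_posteriorK x : K (x + P x) = x.
Proof.
rewrite /K; have -> : G (Spr (x + P x)) = M (obs_map x).
  rewrite (linD lSpr) (linD lG) /= -[G (Spr x)]CK; congr (_ + G _).
  by rewrite SprE.
by rewrite (opinv_eq Minj erefl) addrK.
Qed.

Lemma posterior_precondK x : K x + P (K x) = x.
Proof.
set z := opinv M (G (Spr x)).
have -> : P (K x) = Spr (Gs z).
  congr (Spr (Gs _)); apply: opinv_eq => //.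
  rewrite /K -/z (linB lSpr) (linB lG) SprE -[G (Spr x)]MK -/z /=.
  by rewrite addrK.
by rewrite subrK.
Qed.

Let saK : self_adjoint K.
Proof.
move=> x y; rewrite -{1}(posterior_precondK y) -{2}(posterior_precondK x).
rewrite dotDr [RHS]dotDl; congr (_ + _); exact/esym/precond_hessian_sa.
Qed.

(** Write x = K x + P (K x). Nonnegativity of P gives <K x, x> >= |K x|^2, and |x| <= C |K x| for a
    bound C of 1 + P. At x = Spr u this is the norm equivalence of the two square roots. *)
Lemma precond_posterior_bounds : exists2 C, 0 <= C & forall x,
  `|x| ^+ 2 <= C ^+ 2 * dot (K x) x /\ dot (K x) x <= `|x| ^+ 2.
Proof.
have /bounded_opP[_ [C C0 NC]] := bounded_add (@bounded_id _ H) bP.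
exists C => // x.
have Kx : `|K x| ^+ 2 <= dot (K x) x.
  rewrite -{3}(posterior_precondK x) dotDr dot_normE lerDl dotC.
  exact: nonneg_op_ge0 lP precond_hessian_nonneg _.
have xK : `|x| <= C * `|K x| by rewrite -{1}(posterior_precondK x); exact: NC.
split.
  apply: (@le_trans _ _ ((C * `|K x|) ^+ 2)).
    by rewrite ler_pXn2r ?nnegrE ?mulr_ge0.
  by rewrite exprMn ler_wpM2l // exprn_ge0.
have := le_trans (ler_norm _) (cauchy_schwarz (K x) x).
have := sqr_ge0 (`|K x| - `|x|); nra.
Qed.

Lemma posterior_covE x : Cpos x = Spr (K (Spr x)).
Proof. by rewrite /K (linB lSpr) !SprE. Qed.

Lemma posterior_cov_bounded : bounded_op Cpos.
Proof.
have -> : Cpos = Spr \o K \o Spr by apply/funext => x; rewrite posterior_covE.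
apply: bounded_comp => //; apply: bounded_comp => //.
apply: bounded_sub; first exact: bounded_id.
exact: bounded_comp
  (cV_linear_bounded (linear_comp precond_factor_linear lMi))
  (bounded_comp bG bSpr).
Qed.

Lemma posterior_cov_sa : self_adjoint Cpos.
Proof. by move=> x y; rewrite !posterior_covE saSpr saK -saSpr. Qed.

Lemma posterior_cov_positive : positive_op Cpos.
Proof.
move=> x x0; rewrite posterior_covE saSpr.
have [C C0 /(_ (Spr x))[lower _]] := precond_posterior_bounds.
have Sx : 0 < `|Spr x| ^+ 2.
  rewrite exprn_gt0 // normr_gt0; apply: contra x0 => /eqP Sx; apply/eqP.
  by apply: prior_sqrt_inj; rewrite Sx (lin0 lSpr).
rewrite ltNge; apply: contraTN (lt_le_trans Sx lower) => K0.
by rewrite -leNgt mulr_ge0_le0 ?exprn_ge0.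
Qed.

Lemma posterior_sqrt : is_sqrtop Cpos Spos.
Proof.
exact: sqrtopP posterior_cov_bounded posterior_cov_sa
  (positive_op_nonneg posterior_cov_positive).
Qed.

Let bSpos : bounded_op Spos. Proof. by have [] := posterior_sqrt. Qed.
Let lSpos : linear Spos := proj1 bSpos.
Let saSpos : self_adjoint Spos. Proof. by have [] := posterior_sqrt. Qed.
Let SposE x : Spos (Spos x) = Cpos x.
Proof. by have [_ _ _ /(congr1 (@^~ x))] := posterior_sqrt. Qed.

Lemma posterior_sqrt_inj : injective Spos.
Proof.
apply: sqrtop_inj posterior_sqrt (positive_op_inj _ posterior_cov_positive).
by case: posterior_cov_bounded.
Qed.

Let normSpos u : `|Spos u| ^+ 2 = dot (K (Spr u)) (Spr u).
Proof. by rewrite -dot_normE -saSpos SposE posterior_covE saSpr. Qed.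

Lemma posterior_sqrt_le u : `|Spos u| <= 1 * `|Spr u|.
Proof.
have [C _ /(_ (Spr u))[_ upper]] := precond_posterior_bounds.
by rewrite mul1r -(@ler_pXn2r _ 2) ?nnegrE // normSpos.
Qed.

Lemma prior_sqrt_le : exists2 C, 0 <= C & forall u, `|Spr u| <= C * `|Spos u|.
Proof.
have [C C0 KC] := precond_posterior_bounds; exists C => // u.
rewrite -(@ler_pXn2r _ 2) ?nnegrE ?mulr_ge0 // exprMn normSpos.
by have [] := KC (Spr u).
Qed.

Lemma transfer_A : [/\ bounded_op A, forall x, Spr (A x) = Spos x
  & forall u, adjoint A (Spr u) = Spos u].
Proof.
exact: (douglas lSpr saSpr prior_sqrt_inj lSpos saSpos ler01 posterior_sqrt_le).
Qed.

Lemma transfer_B : [/\ bounded_op B, forall x, Spos (B x) = Spr x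
  & forall u, adjoint B (Spos u) = Spr u].
Proof.
have [C C0 CS] := prior_sqrt_le.
exact: (douglas lSpos saSpos posterior_sqrt_inj lSpr saSpr C0 CS).
Qed.

Lemma transfer_AK x : B (A x) = x.
Proof.
have [_ SA _] := transfer_A; have [_ SB _] := transfer_B.
by apply: posterior_sqrt_inj; rewrite SB SA.
Qed.

Lemma transfer_BK x : A (B x) = x.
Proof.
have [_ SA _] := transfer_A; have [_ SB _] := transfer_B.
by apply: prior_sqrt_inj; rewrite SA SB.
Qed.

Let adjA : forall x y, dot (A x) y = dot x (adjoint A y).
Proof. by have [bA _ _] := transfer_A; exact: adjoint_bounded. Qed.
Let adjB : forall x y, dot (B x) y = dot x (adjoint B y).
Proof. by have [bB _ _] := transfer_B; exact: adjoint_bounded. Qed.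
Let lAs : linear (adjoint A) := adjoint_linear adjA.

(** Cancelling Spr in Spr A Spos = Cpos = Spr K Spr gives A Spos = K Spr. Its adjoint is Spos A^* =
    Spr K, where Spos = Spr A, and Spr cancels again. *)
Lemma transfer_A_adjoint x : A (adjoint A x) = K x.
Proof.
have [_ SA AS] := transfer_A.
have ASpos u : A (Spos u) = K (Spr u).
  by apply: prior_sqrt_inj; rewrite SA SposE posterior_covE.
apply: prior_sqrt_inj; apply: dot_ext => u.
rewrite SA saSpos dotC -adjA ASpos saK dotC saSpr.
by [].
Qed.

Lemma transfer_B_adjointA x : B x = adjoint A (x + P x).
Proof. by rewrite -{1}(precond_posteriorK x) -transfer_A_adjoint transfer_AK. Qed.

Lemma transfer_B_square x : adjoint B (B x) = x + P x.
Proof.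
apply: dot_ext => u; rewrite dotC -adjB [B x]transfer_B_adjointA -adjA.
by rewrite transfer_BK dotC.
Qed.

Lemma posterior_hessianE x : Spos (Hop (Spos x)) = adjoint A (P (A x)).
Proof. by have [_ SA AS] := transfer_A; rewrite /= SA AS. Qed.

(** Apply B = A^* (1 + P) to A x, using B A = 1. *)
Lemma transfer_A_square x : adjoint A (A x) = x - Spos (Hop (Spos x)).
Proof.
rewrite posterior_hessianE -[in X in X - _](transfer_AK x) transfer_B_adjointA.
by rewrite (linD lAs) addrK.
Qed.

End Posterior.

(** * Diagonal operators *)

Lemma diag_series_finite (R : realType) (H : hilbertType R) (T : H -> H)
    (c : nat -> R) (e : nat -> H) r :
  (forall i, (i < r)%N -> basis_idx H i) -> (forall i, (r <= i)%N -> c i = 0) ->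
  (forall x, T x = \sum_(i < r) (c i * dot (e i) x) *: e i) ->
  diag_series T c e.
Proof.
move=> rI c0 TE eps eps0; exists r => // N /= rN h.
rewrite (big_cat_nat (leq0n r) rN) /=.
rewrite [\sum_(r <= i < N | _) _]big_nat_cond [\sum_(r <= i < N | _) _]big1.
  rewrite addr0 big_mkcond big_mkord (_ : \sum_(i < r) _ = T h).
    by rewrite subrr normr0 mulr_ge0 // ltW.
  rewrite TE; apply: eq_bigr => i _; rewrite ifT ?scalerA //.
  exact/mem_set/rI.
by move=> i /andP[/andP[ri _] _]; rewrite c0 // scale0r.
Qed.

(** A bounded surjection carries a dense span to a dense span, and the scalings are absorbed into
    the coefficients. *)
Lemma orthonormal_basis_image (R : realType) (H : hilbertType R) (B : H -> H)
    (s : nat -> R) (w : nat -> H) :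
  bounded_op B -> (forall y, range B y) -> orthonormal_basis w ->
  (forall i, s i != 0) ->
  (forall i j, basis_idx H i -> basis_idx H j ->
     dot (s i *: B (w i)) (s j *: B (w j)) = (i == j)%:R) ->
  orthonormal_basis (fun i => s i *: B (w i)).
Proof.
move=> /bounded_opP[lB [C C0 BC]] Bsurj [_ /denseP dw] s0 ow.
split=> //; apply/denseP => y e e0; have [x _ <-] := Bsurj y.
have C1 : 0 < C + 1 by rewrite ltr_wpDl.
have [_ [N [a ->]] xe] := dw x _ (divr_gt0 e0 C1).
set z := \sum_(0 <= i < N | _) _ in xe; exists (B z).
  exists N, (fun i => a i / s i).
  rewrite (lin_sum _ _ _ lB); apply: eq_bigr => i _.
  by rewrite (linZ _ lB) scalerA divfK.
rewrite -(linB lB); apply: le_lt_trans (BC _) _.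
move: xe; rewrite ltr_pdivlMr // mulrC; apply: le_lt_trans.
by rewrite mulrDl mul1r lerDl.
Qed.

(* The range of [S \o T] is orthogonal to the kernel of [S \o T \o S], hence
   it is contained in the span of the [w i]. *)
Lemma rank_of_diagonal (R : realType) (H : hilbertType R) (S T : H -> H) r
    (w : nat -> H) (mu : nat -> R) :
  linear S -> self_adjoint S -> injective S -> linear T -> self_adjoint T ->
  orthonormal r w -> (forall i, (i < r)%N -> mu i != 0) ->
  (forall x, S (T (S x)) = \sum_(i < r) (mu i * dot (w i) x) *: w i) ->
  rank T = `I_r.
Proof.
move=> lS saS Sinj lT saT ow mu0 STS; apply/seteqP; split=> k /=; last first.
  (* These vectors are independent because S maps them to mu_i w_i. *)
  move=> kr; exists (fun i : 'I_k.+1 => T (S (w i))) => [i|a a0 i].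
    by exists (S (w i)).
  have ik j : (j < k.+1)%N -> (j < r)%N by move=> jk; exact: leq_trans kr.
  have ow' : orthonormal k.+1 w by move=> p q pk qk; apply: ow; exact: ik.
  have eig (j : 'I_k.+1) : S (T (S (w j))) = mu j *: w j.
    rewrite STS (bigD1 (Ordinal (ik _ (ltn_ord j)))) //= ow ?ik // eqxx mulr1.
    rewrite big1 ?addr0 // => q qj.
    rewrite ow //; last exact: (ik _ (ltn_ord j)).
    rewrite (_ : (q : nat) == j = false) ?mulr0 ?scale0r //; exact/negbTE.
  have : \sum_(j < k.+1) (a j * mu j) *: w j = 0.
    transitivity (S (\sum_(j < k.+1) a j *: T (S (w j)))); last first.
      by rewrite a0 lin0.
    rewrite (lin_sum _ _ _ lS); apply: eq_bigr => j _.
    by rewrite (linZ _ lS) eig scalerA.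
  move=> s0; have /eqP := orthonormal_lin_indep ow' s0 i.
  by rewrite mulf_eq0 (negbTE (mu0 _ (ik _ (ltn_ord i)))) orbF => /eqP.
move=> [e eT indep].
pose L (c : 'cV[R]_r) := \sum_(i < r) c i 0 *: w i.
have lL : linear L.
  move=> a b c; rewrite /L scaler_sumr -big_split; apply: eq_bigr => j _ /=.
  by rewrite !mxE scalerDl scalerA.
apply: (@lin_indep_range_cV R r k.+1 H L (S \o e) lL); last first.
  move=> a a0; apply: indep; apply: Sinj.
  rewrite (lin0 lS) (lin_sum _ _ _ lS) -[RHS]a0.
  by apply: eq_bigr => i _; rewrite (linZ _ lS).
move=> i /=; have [x _ <-] := eT i.
exists (\col_j dot (w j) (S (T x))) => //; apply/esym/subr0_eq.
rewrite /L; under eq_bigr do rewrite mxE.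
set y := _ - _; have wy j : (j < r)%N -> dot (w j) y = 0.
  move=> jr; rewrite /y dotBr (dot_orthonormal_sum _ (Ordinal jr) ow) /=.
  by rewrite subrr.
have TSy : T (S y) = 0.
  apply: Sinj; rewrite STS (lin0 lS) big1 // => j _.
  by rewrite wy // mulr0 scale0r.
(* y is orthogonal to the w_j, and <y, S (T x)> = <T (S y), x> = 0. *)
apply: dot_eq0; rewrite {2}/y dotBr dotC saS saT TSy dot0r sub0r.
rewrite dot_sumr big1 ?oppr0 // => j _.
by rewrite dotZr (dotC y) wy // mulr0.
Qed.

Lemma esum_finite_support (R : realType) (D : set nat) (f : nat -> R) r :
  (forall i, 0 <= f i) -> (forall i, (r <= i)%N -> f i = 0) ->
  (\esum_(i in D) (f i)%:E < +oo)%E.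
Proof.
move=> f0 fr.
have fE i : D i -> (0 <= (f i)%:E)%E by rewrite lee_fin.
rewrite (esumID `I_r) // (esum1 (D := D `&` ~` `I_r)) ?adde0; last first.
  by move=> i [_ /negP]; rewrite -leqNgt => /fr ->.
have fin : finite_set (D `&` `I_r) by apply: finite_setIr; exact: finite_II.
rewrite esum_fset //; first by rewrite fsumEFin // ltry.
by move=> i /set_mem[/fE].
Qed.


Theorem proposition3p7 (R : realType) (H : hilbertType R) (n : nat)
    (G : H -> 'cV[R]_n) (Cobs : 'cV[R]_n -> 'cV[R]_n) (Cpr : H -> H)
    (H_separable : separable H)
    (G_bounded : bounded_op G)
    (Cobs_bounded : bounded_op Cobs)
    (Cobs_sa : self_adjoint Cobs) (Cobs_pos : positive_op Cobs)
    (Cpr_trace : trace_class Cpr)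
    (Cpr_sa : self_adjoint Cpr) (Cpr_pos : positive_op Cpr) :
  let Hop := hessian G Cobs in
  let Cpos := posterior_cov G Cobs Cpr in
  let Spr := sqrtop Cpr in
  let Spos := sqrtop Cpos in
  let A := opinv Spr \o Spos in
  let B := opinv Spos \o Spr in
  let I := basis_idx H in
  exists (lam : nat -> R) (w v : nat -> H),
    ((forall i j, I i -> I j -> (i <= j)%N -> lam i <= lam j) /\
     ell2 H `]-1, 0] lam /\
     ([set i | I i /\ lam i != 0] #= rank Hop)%card) /\
    (orthonormal_basis w /\ orthonormal_basis v) /\
    (forall i, I i ->
       [/\ range Spr (w i), range Spr (v i)
         & v i = Num.sqrt (1 + lam i) *: opinv Spos (Spr (w i))]) /\
    diag_series (rdiv Cpos Cpr) lam w /\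
    (Spr \o Hop \o Spr = (adjoint B \o B) \- id /\
     diag_series (Spr \o Hop \o Spr) (fun i => - lam i / (1 + lam i)) w) /\
    (Spos \o Hop \o Spos = id \- (adjoint A \o A) /\
     diag_series (Spos \o Hop \o Spos) (fun i => - lam i) v) /\
    (forall i, I i ->
       Spos (opinv Spr (w i)) = (1 + lam i) *: opinv Spos (Spr (w i))).
Proof.
move=> Hop Cpos Spr Spos A B I.
have [bCpr _] := Cpr_trace.
pose P := Spr \o Hop \o Spr.
pose K := precond_posterior G Cobs Cpr.
have [bSpr saSpr _ _] := prior_sqrt bCpr Cpr_sa Cpr_pos.
have lSpr : linear Spr by case: bSpr.
have Sinj : injective Spr by exact: prior_sqrt_inj.
have [bA SA AS] : [/\ bounded_op A, forall x, Spr (A x) = Spos x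
  & forall u, adjoint A (Spr u) = Spos u] by exact: transfer_A.
have [bB SB BS] : [/\ bounded_op B, forall x, Spos (B x) = Spr x
  & forall u, adjoint B (Spos u) = Spr u] by exact: transfer_B.
have AK x : B (A x) = x by exact: transfer_AK.
have adjA := adjoint_bounded bA; have lAs := adjoint_linear adjA.
have adjB := adjoint_bounded bB; have lB : linear B by case: bB.
have AA x : A (adjoint A x) = K x by exact: transfer_A_adjoint.
have BA x : B x = adjoint A (x + P x) by exact: transfer_B_adjointA.
have BB x : adjoint B (B x) = x + P x by exact: transfer_B_square.
have SHS x : Spos (Hop (Spos x)) = adjoint A (P (A x)).
  exact: posterior_hessianE.
have AsA x : adjoint A (A x) = x - Spos (Hop (Spos x)).
  exact: transfer_A_square.
have KP x : K (x + P x) = x by exact: precond_posteriorK.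
have lHop : linear Hop by exact: hessian_linear.
have saHop : self_adjoint Hop by exact: hessian_sa.
have [r [w0 [mu [ow0 mu_gt0 mono PE]]]] : exists r w mu, [/\ orthonormal r w,
    forall i, (i < r)%N -> 0 < mu i,
    forall i j, (i <= j)%N -> (j < r)%N -> mu j <= mu i
    & forall x, P x = \sum_(i < r) (mu i * dot (w i) x) *: w i].
  apply: (@finite_rank_spectral R H n (Spr \o adjoint G) _ (obs_map G Cobs Cpr)).
  - exact: precond_factor_linear.
  - exact: obs_map_bounded.
  - exact: precond_hessian_sa.
  - exact: precond_hessian_nonneg.
(* Extension by zero gives the eigenvalues on the completed basis and stays nonincreasing because mu
   > 0. *)
pose m i := if (i < r)%N then mu i else 0.
have m_ge0 i : 0 <= m i by rewrite /m; case: ifP => // /mu_gt0/ltW.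
have m1 i : 1 + m i != 0 by rewrite gt_eqF // ltr_pwDl.
have m_mono i j : (i <= j)%N -> m j <= m i.
  move=> ij; rewrite {1}/m; case: ifP => // jr.
  by rewrite /m (leq_ltn_trans ij jr) mono.
have [d0 d0dense] := separable_sequence H_separable.
have [C C0 SC] : exists2 C, 0 < C & forall x, `|Spr x| <= C * `|x|.
  have /bounded_opP[_ [C C0 SC]] := bSpr.
  exists (C + 1) => [|x]; first by rewrite ltr_wpDl.
  by apply: le_trans (SC x) _; rewrite ler_wpM2r // lerDl.
(* Spr maps the dense sequence to one that is dense in its own dense range. *)
have dS x e : 0 < e -> exists k, `|x - Spr (d0 k)| < e.
  move=> e0; have e2 : 0 < e / 2 by rewrite divr_gt0.
  have [u xu] := dense_range_sa x lSpr saSpr Sinj e2.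
  have [k uk] := d0dense u _ (divr_gt0 e2 C0); exists k.
  rewrite (splitr e) -(subrK (Spr u) x) -addrA.
  apply: le_lt_trans (ler_normD _ _) _; apply: ltrD => //.
  rewrite -(linB lSpr); apply: le_lt_trans (SC _) _.
  by rewrite mulrC -ltr_pdivlMr.
have Pw0 i : (i < r)%N -> P (w0 i) = mu i *: w0 i.
  move=> ir; rewrite PE (bigD1 (Ordinal ir)) //= ow0 // eqxx mulr1.
  rewrite big1 ?addr0 // => q qi; rewrite ow0 //.
  rewrite (_ : (q : nat) == i = false) ?mulr0 ?scale0r //; exact/negbTE.
have w0S i : (i < r)%N -> range Spr (w0 i).
  move=> ir; exists ((mu i)^-1 *: Hop (Spr (w0 i))) => //.
  rewrite (linZ _ lSpr) -[Spr (Hop _)]/(P (w0 i)) Pw0 // scalerA mulVf ?scale1r //.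
  by rewrite gt_eqF // mu_gt0.
have [w [wB ww0 rI wS]] := orthonormal_basis_extension lSpr ow0 w0S dS.
have [ow _] := wB.
have PwE x : P x = \sum_(i < r) (m i * dot (w i) x) *: w i.
  by rewrite PE; apply: eq_bigr => i _; rewrite /m ltn_ord ww0.
have Pw i : I i -> P (w i) = m i *: w i.
  move=> Ii; rewrite PwE /m; case: ifP => [ir|/negbT].
    rewrite (bigD1 (Ordinal ir)) //= ow // eqxx mulr1 ir.
    rewrite big1 ?addr0 // => q qi; rewrite ow //; last exact: rI.
    rewrite (_ : (q : nat) == i = false) ?mulr0 ?scale0r //; exact/negbTE.
  rewrite -leqNgt scale0r => ri; rewrite big1 // => q _.
  rewrite ow //; last exact: rI.
  by rewrite ltn_eqF ?mulr0 ?scale0r // (leq_trans _ ri).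
pose lam i := (1 + m i)^-1 - 1.
have lam1 i : 1 + lam i = (1 + m i)^-1 by rewrite addrC subrK.
have lamD i : - lam i = m i * (1 + m i)^-1 by rewrite /lam; field.
have lamQ i : - lam i / (1 + lam i) = m i by rewrite lamD lam1 invrK divfK.
have lam_gt i : 0 < 1 + lam i by rewrite lam1 invr_gt0 ltr_pwDl.
have m_out i : (r <= i)%N -> m i = 0 by rewrite /m ltnNge => ->.
have lam_out i : (r <= i)%N -> lam i = 0.
  by move=> /m_out mi; rewrite /lam mi addr0 invr1 subrr.
have lam_in i : (i < r)%N -> lam i != 0.
  move=> ir; rewrite -oppr_eq0 lamD mulf_neq0 ?invr_eq0 //.
  by rewrite /m ir gt_eqF // mu_gt0.
have lam_le0 i : lam i <= 0.
  by rewrite -oppr_ge0 lamD mulr_ge0 // -lam1 ltW.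
pose s i := Num.sqrt (1 + lam i).
have s_sq i : s i * s i = 1 + lam i by rewrite -expr2 sqr_sqrtr // ltW.
have s0 i : s i != 0 by rewrite gt_eqF // sqrtr_gt0.
pose v i := s i *: B (w i).
(* For w_i = Spr u the left side is Spos u, so this is the last claimed identity. *)
have Asw i : I i -> adjoint A (w i) = (1 + lam i) *: B (w i).
  move=> Ii; rewrite BA Pw // -{2}(scale1r (w i)) -scalerDl (linZ _ lAs).
  by rewrite scalerA lam1 mulVf // scale1r.
have Asv i : I i -> adjoint A (w i) = s i *: v i.
  by move=> Ii; rewrite Asw // scalerA s_sq.
exists lam, w, v; split; last split; last split; last split; last split; last split.
- split; last split.
  + move=> i j _ _ ij; rewrite lerD2r lef_pV2 ?posrE ?ltr_pwDl //.
    by rewrite lerD2l m_mono.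
  + split.
      by move=> i _; rewrite in_itv /= lam_le0 andbT; have := lam_gt i; lra.
    apply: (@esum_finite_support _ _ _ r) => i; first exact: sqr_ge0.
    by move=> /lam_out ->; rewrite expr0n.
  + rewrite (_ : rank Hop = `I_r); last first.
      apply: (@rank_of_diagonal _ _ Spr _ _ w0 mu) => //.
      by move=> i ir; rewrite gt_eqF // mu_gt0.
    rewrite (_ : [set i | _] = `I_r) ?card_eqxx //.
    apply/seteqP; split=> i /= => [[_]|ir]; last first.
      by split; [exact: rI|exact: lam_in].
    by rewrite ltnNge; apply: contraNN => /lam_out ->.
- split=> //; apply: orthonormal_basis_image => //.
    by move=> y; exists (A y).
  move=> i j Ii Ij; rewrite dotZl dotZr adjB BB Pw //.
  rewrite -{1}(scale1r (w j)) -scalerDl dotZr ow //.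
  have [->|_] := eqVneq i j; last by rewrite !mulr0.
  by rewrite mulr1 mulrA s_sq lam1 mulVf.
- move=> i Ii; split; [exact: wS| |by []].
  have [u _ uw] := wS _ Ii.
  (* s_i v_i = A^* w_i = A^* Spr u = Spos u = Spr (A u). *)
  exists ((s i)^-1 *: A u) => //.
  apply: (scalerI (s0 i)); rewrite -Asv // (linZ _ lSpr) scalerA divff // scale1r.
  by rewrite SA -uw AS.
- apply: (@diag_series_finite _ _ _ _ _ r) => // x.
  set y := \sum_(i < r) _.
  have wy (i : 'I_r) : dot (w i) y = lam i * dot (w i) x.
    rewrite (dot_orthonormal_sum (fun j : 'I_r => lam j * dot (w j) x) i) //.
    by move=> p q pr qr; apply: ow; exact: rI.
  (* As K inverts 1 + P, it suffices that 1 + P maps x + y to x, which holds since lam_i + m_i (1 +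
     lam_i) = 0. *)
  have KE : K x = x + y.
    rewrite -[RHS]KP; congr (K _). rewrite PwE -addrA -[LHS]addr0; congr (_ + _).
    rewrite -big_split big1 // => i _ /=.
    rewrite -scalerDl dotDr wy (_ : _ + _ = 0) ?scale0r //.
    by rewrite /lam; field.
  by rewrite /rdiv /= -/A -[opinv _ _]/(A (adjoint A x)) AA KE addrAC subrr add0r.
- split; first by apply/funext => x; rewrite /= BB addrAC subrr add0r.
  apply: (@diag_series_finite _ _ _ _ _ r) => // [i|x]; first by rewrite lamQ => /m_out.
  by rewrite -[LHS]/(P x) PwE; apply: eq_bigr => i _; rewrite lamQ.
- split.
    apply/funext => x; by rewrite [RHS]/= AsA opprB addrC subrK.
  apply: (@diag_series_finite _ _ _ _ _ r) => // [i|x].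
    by move=> /lam_out ->; rewrite oppr0.
  (* In A^* P A both A^* w_i and <w_i, A x> contribute a factor s_i, so the coefficient is m_i s_i^2
     = -lam_i. *)
  rewrite [LHS]SHS PwE (lin_sum _ _ _ lAs).
  apply: eq_bigr => i _; have Ii := rI _ (ltn_ord i).
  rewrite (linZ _ lAs) dotC adjA Asv // dotZr scalerA; congr (_ *: _).
  by rewrite lamD -lam1 -s_sq (dotC x); ring.
- move=> i Ii; rewrite -Asw //; have [u _ uw] := wS _ Ii.
  by rewrite -uw AS (opinv_eq Sinj erefl).
Qed.
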